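(* Let $R$ and $A$ be Noetherian algebras, and let $\varphi\colon R\to A$ be a Frobenius extension. Assume $A$ is faithfully flat as a right $R$-module. For each $k>0$, the ring $R$ is left quasi $k$-Gorenstein if and only if $A$ is left quasi $k$-Gorenstein.
   Context: A ring is Noetherian if it is left and right Noetherian. Modules are left modules unless stated otherwise. A ring homomorphism $R\to A$ is finite if $A$ is finitely generated both as a left and as a right $R$-module. A ring $A$ is a Noetherian algebra if there is a finite ring homomorphism $S\to A$ with $S$ a commutative Noetherian ring whose image lies in the center of $A$. A ring homomorphism $R\to A$ is a Frobenius extension if $A$ is a finitely generated projective left $R$-module and $A\cong\operatorname{Hom}_R(A,R)$ as $A$-$R$-bimodules; equivalently, $A$ is a finitely generated projective right $R$-module and $A\cong\operatorname{Hom}_{R^{\mathrm{op}}}(A,R)$ as $R$-$A$-bimodules. Let $0\to R\to I^0\to I^1\to\cdots$ be a minimal injective resolution of the left $R$-module $R$, and $k$ a positive integer. The Noetherian ring $R$ is left quasi $k$-Gorenstein if the flat dimensions satisfy $\operatorname{fd}_R(I^i)\le i+1$ for all $0\le i\le k-1$. *)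

(* Defs.v *)
From HB Require Import structures.
From mathcomp Require Import all_boot all_algebra.
From mathcomp Require Import boolp.

Set Implicit Arguments.
Unset Strict Implicit.
Unset Printing Implicit Defensive.

Import GRing.Theory.
Local Open Scope ring_scope.
Local Open Scope quotient_scope.

(* Rings are unital, associative and possibly zero (pzRingType). Left           *)
(* R-modules are lmodType R, right R-modules are lmodType R^c, where R^c is     *)
(* the opposite ring. The left module R is R^o, the right module R is (R^c)^o.  *)

Section Restriction.
Variables (R A : pzRingType) (f : {rmorphism R -> A}).

Section RestrLmodule.
Variable V : lmodType A.

Let carrier : Type := V.
HB.instance Definition _ := GRing.Zmodule.on carrier.

Let scale (r : R) (v : carrier) : carrier := f r *: (v : V).

Fact restr_scaleA a b v : scale a (scale b v) = scale (a * b) v.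
Proof. by rewrite /scale scalerA rmorphM. Qed.
Fact restr_scale1 : left_id 1 scale.
Proof. by move=> v; rewrite /scale rmorph1 scale1r. Qed.
Fact restr_scaleDr : right_distributive scale +%R.
Proof. by move=> a u v; rewrite /scale scalerDr. Qed.
Fact restr_scaleDl v : {morph scale^~ v : a b / a + b}.
Proof. by move=> a b; rewrite /scale rmorphD scalerDl. Qed.

(* Restriction of scalars along f. *)
Definition restr : lmodType R :=
  HB.pack carrier (GRing.Zmodule_isLmodule.Build R carrier
    restr_scaleA restr_scale1 restr_scaleDr restr_scaleDl).

End RestrLmodule.

Let op_fun : R^c -> A^c := f.

Fact fop_additive : zmod_morphism op_fun. Proof. exact: (rmorphB f). Qed.
Fact fop_monoid : monoid_morphism op_fun.
Proof. by split=> [|x y]; [exact: (rmorph1 f) | exact: (rmorphM f y x)]. Qed.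

(* f between the opposite rings *)
Definition fop : {rmorphism R^c -> A^c} :=
  HB.pack op_fun (GRing.isZmodMorphism.Build R^c A^c op_fun fop_additive)
    (GRing.isMonoidMorphism.Build R^c A^c op_fun fop_monoid).

Definition left_restr : lmodType R := restr A^o.

End Restriction.

(* A as a right R-module *)
Definition right_restr (R A : pzRingType) (f : {rmorphism R -> A}) :
  lmodType R^c := restr (fop f) (A^c)^o.

Lemma left_restrE (R A : pzRingType) (f : {rmorphism R -> A}) (r : R) (x : A) :
  r *: (x : left_restr f) = f r * x :> A.
Proof. by []. Qed.

Lemma right_restrE (R A : pzRingType) (f : {rmorphism R -> A}) (r : R) (x : A) :
  (r : R^c) *: (x : right_restr f) = x * f r :> A.
Proof. by []. Qed.

Section Finiteness.
Variables (R : pzRingType) (V : lmodType R).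

Definition submodule (P : V -> Prop) : Prop :=
  P 0 /\ forall (a : R) (u v : V), P u -> P v -> P (a *: u + v).

Definition spanned n (e : 'I_n -> V) (v : V) : Prop :=
  exists c : 'I_n -> R, v = \sum_(i < n) c i *: e i.

Definition fin_gen : Prop := exists n (e : 'I_n -> V), forall v, spanned e v.

End Finiteness.

Definition left_noetherian (R : pzRingType) : Prop :=
  forall I : R^o -> Prop, submodule I ->
    exists n (e : 'I_n -> R^o), forall x, I x <-> spanned e x.

Definition noetherian (R : pzRingType) : Prop :=
  left_noetherian R /\ left_noetherian R^c.

Definition finite_hom (R A : pzRingType) (f : {rmorphism R -> A}) : Prop :=
  fin_gen (left_restr f) /\ fin_gen (right_restr f).

Definition noetherian_algebra (A : pzRingType) : Prop :=
  exists (S : comPzRingType) (f : {rmorphism S -> A}),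
    [/\ noetherian S, finite_hom f & forall s a, f s * a = a * f s].

Section HomologicalAlgebra.
Variable R : pzRingType.
Implicit Types M N E P : lmodType R.

Definition projective P : Prop :=
  forall M N (g : {linear M -> N}) (h : {linear P -> N}),
    (forall y, exists x, g x = y) ->
    exists h' : {linear P -> M}, forall x, g (h' x) = h x.

Definition injective_module E : Prop :=
  forall M N (g : {linear M -> N}) (h : {linear M -> E}),
    injective g ->
    exists h' : {linear N -> E}, forall x, h' (g x) = h x.

(* N is an essential extension of the image of g *)
Definition essential_image M N (g : M -> N) : Prop :=
  forall U : N -> Prop, submodule U ->
    (forall x, U (g x) -> g x = 0) -> forall y, U y -> y = 0.

End HomologicalAlgebra.

Definition exact (U V W : zmodType) (f : U -> V) (g : V -> W) : Prop :=
  forall y, g y = 0 <-> exists x, f x = y.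

Section Tensor.
Variables (R : pzRingType) (N : lmodType R^c) (M : lmodType R).

(* A list of pairs stands for the sum of the pure tensors x (x) y; no formal    *)
(* negatives are needed, as - (x (x) y) = (- x) (x) y.                          *)
Inductive tensor_rel : seq (N * M) -> seq (N * M) -> Prop :=
| TRrefl s : tensor_rel s s
| TRsym s t : tensor_rel s t -> tensor_rel t s
| TRtrans t s u : tensor_rel s t -> tensor_rel t u -> tensor_rel s u
| TRcat s s' t t' : tensor_rel s s' -> tensor_rel t t' ->
    tensor_rel (s ++ t) (s' ++ t')
| TRcomm s t : tensor_rel (s ++ t) (t ++ s)
| TRaddl x x' y : tensor_rel [:: (x + x', y)] [:: (x, y); (x', y)]
| TRaddr x y y' : tensor_rel [:: (x, y + y')] [:: (x, y); (x, y')]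
| TRzero y : tensor_rel [:: (0, y)] [::]
| TRbal (r : R) x y : tensor_rel [:: ((r : R^c) *: x, y)] [:: (x, r *: y)].

Definition tensor_relb : rel (seq (N * M)) := fun s t => `[< tensor_rel s t >].

Fact tensor_relb_refl : reflexive tensor_relb.
Proof. by move=> s; apply/asboolP; exact: TRrefl. Qed.
Fact tensor_relb_sym : symmetric tensor_relb.
Proof. by move=> s t; apply/asboolP/asboolP; exact: TRsym. Qed.
Fact tensor_relb_trans : transitive tensor_relb.
Proof.
by move=> t s u /asboolP st /asboolP tu; apply/asboolP; exact: TRtrans st tu.
Qed.

Canonical tensor_equiv :=
  EquivRel tensor_relb tensor_relb_refl tensor_relb_sym tensor_relb_trans.

Definition tensor : Type := {eq_quot tensor_equiv}.

HB.instance Definition _ := Choice.on tensor.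

Definition tclass (s : seq (N * M)) : tensor := \pi_{eq_quot tensor_equiv} s.

Lemma tclassP s t : tclass s = tclass t <-> tensor_rel s t.
Proof.
split=> [/eqP|st]; first by rewrite /tclass eqmodE => /asboolP.
by apply/eqP; rewrite /tclass eqmodE; apply/asboolP.
Qed.

Definition trepr (u : tensor) : seq (N * M) := repr u.

Lemma treprK u : tclass (trepr u) = u. Proof. exact: reprK. Qed.

Definition tzero : tensor := tclass [::].
Definition tadd (u v : tensor) : tensor := tclass (trepr u ++ trepr v).
Definition topp (u : tensor) : tensor :=
  tclass [seq (- p.1, p.2) | p <- trepr u].

Lemma tadd_class s t : tadd (tclass s) (tclass t) = tclass (s ++ t).
Proof. by apply/tclassP; apply: TRcat; apply/tclassP; rewrite treprK. Qed.

Fact taddA : associative tadd.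
Proof.
move=> u v w; rewrite -(treprK u) -(treprK v) -(treprK w).
by rewrite !tadd_class catA.
Qed.
Fact taddC : commutative tadd.
Proof. by move=> u v; apply/tclassP; exact: TRcomm. Qed.
Fact tadd0 : left_id tzero tadd.
Proof. by move=> u; rewrite -(treprK u) tadd_class. Qed.
Fact taddN : left_inverse tzero topp tadd.
Proof.
move=> u; rewrite -[in X in tadd _ X](treprK u) tadd_class /tzero.
elim: (trepr u) => [//|[x y] s IH] /=.
have -> : forall a l, a :: l = [:: a] ++ l by [].
set s' := map _ s; rewrite -cat1s -[_ :: s]cat1s.
rewrite -tadd_class -[tclass (s' ++ _)]tadd_class -[tclass ([:: (x, y)] ++ _)]tadd_class.
rewrite [tadd (tclass [:: (x, y)]) _]taddC !taddA -[tadd (tadd _ _) (tclass s)]taddA.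
rewrite [tadd (tclass s') _]tadd_class IH -[tadd _ (tclass [:: (x, y)])]taddA.
rewrite [tadd (tclass [::]) _]tadd0 tadd_class; apply/tclassP.
by apply: TRtrans (TRsym (TRaddl (- x) x y)) _; rewrite addNr; exact: TRzero.
Qed.

HB.instance Definition _ := GRing.isZmodule.Build tensor taddA taddC tadd0 taddN.

End Tensor.

Section TensorMap.
Variables (R : pzRingType) (N N' : lmodType R^c) (M M' : lmodType R).

Definition tensor_map (g : {linear N -> N'}) (h : {linear M -> M'})
    (u : tensor N M) : tensor N' M' :=
  tclass [seq (g p.1, h p.2) | p <- trepr u].

Lemma tensor_map_class (g : {linear N -> N'}) (h : {linear M -> M'}) s :
  tensor_map g h (tclass s) = tclass [seq (g p.1, h p.2) | p <- s].
Proof.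
have rel_map t t' : tensor_rel t t' ->
    tensor_rel [seq (g p.1, h p.2) | p <- t] [seq (g p.1, h p.2) | p <- t'].
  elim=> {t t'} /=.
  - by move=> t; exact: TRrefl.
  - by move=> t t' _; exact: TRsym.
  - by move=> t1 t2 t3 _ H1 _; exact: TRtrans.
  - by move=> t1 t2 t3 t4 _ H1 _ H2; rewrite !map_cat; exact: TRcat.
  - by move=> t t'; rewrite !map_cat; exact: TRcomm.
  - by move=> x x' y; rewrite linearD; exact: TRaddl.
  - by move=> x y y'; rewrite linearD; exact: TRaddr.
  - by move=> y; rewrite linear0; exact: TRzero.
  - by move=> r x y; rewrite !linearZ; exact: TRbal.
by apply/tclassP/rel_map/tclassP; rewrite treprK.
Qed.

End TensorMap.

Section TensorUniversal.
Variables (R : pzRingType) (N : lmodType R^c) (M : lmodType R) (G : zmodType).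
Variable b : N -> M -> G.
Hypothesis bDl : forall x x' y, b (x + x') y = b x y + b x' y.
Hypothesis bDr : forall x y y', b x (y + y') = b x y + b x y'.
Hypothesis bZ : forall (r : R) x y, b ((r : R^c) *: x) y = b x (r *: y).

Lemma tensor_universal :
  exists h : {additive tensor N M -> G}, forall x y, h (tclass [:: (x, y)]) = b x y.
Proof.
pose B (s : seq (N * M)) := \sum_(p <- s) b p.1 p.2.
have BE s t : tensor_rel s t -> B s = B t.
  rewrite /B; elim=> {s t} //=.
  - by move=> t1 t2 t3 _ -> _ ->.
  - by move=> t1 t2 t3 t4 _ H1 _ H2; rewrite !big_cat /= H1 H2.
  - by move=> s t; rewrite !big_cat /= addrC.
  - by move=> x x' y; rewrite !big_cons !big_nil /= bDl !addr0.
  - by move=> x y y'; rewrite !big_cons !big_nil /= bDr !addr0.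
  - move=> y; rewrite big_cons !big_nil /= addr0.
    by apply: (addrI (b 0 y)); rewrite -bDl !addr0.
  - by move=> r x y; rewrite !big_cons !big_nil /= bZ.
pose h (u : tensor N M) := B (trepr u).
have hE s : h (tclass s) = B s by apply/BE/tclassP; rewrite treprK.
have hD : {morph h : u v / u + v}.
  move=> u v; rewrite -(treprK u) -(treprK v) [_ + _]tadd_class !hE.
  by rewrite /B big_cat.
have hB : zmod_morphism h.
  by move=> u v; apply: (addIr (h v)); rewrite -hD !subrK.
pose hL := GRing.isZmodMorphism.Build _ _ h hB.
pose hA : {additive tensor N M -> G} := HB.pack h hL.
by exists hA => x y; rewrite /= hE /B big_cons big_nil addr0.
Qed.

End TensorUniversal.

(* the left module F is flat: - (x)_R F is exact *)
Definition flat (R : pzRingType) (F : lmodType R) : Prop :=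
  forall (N1 N2 N3 : lmodType R^c) (g : {linear N1 -> N2}) (h : {linear N2 -> N3}),
    exact g h ->
    exact (tensor_map g (idfun : {linear F -> F}))
          (tensor_map h (idfun : {linear F -> F})).

(* the right module N is faithfully flat: N (x)_R - preserves and reflects      *)
(* exact sequences                                                              *)
Definition faithfully_flat_right (R : pzRingType) (N : lmodType R^c) : Prop :=
  forall (M1 M2 M3 : lmodType R) (g : {linear M1 -> M2}) (h : {linear M2 -> M3}),
    exact g h <->
    exact (tensor_map (idfun : {linear N -> N}) g)
          (tensor_map (idfun : {linear N -> N}) h).

(* fd_R M <= n: there is an exact sequence                                      *)
(*   0 -> F_n -> ... -> F_1 -> F_0 -> M -> 0                                    *)
(* with all F_i flat, padded by F_i = 0 for i > n.                              *)
Definition flat_dim_le (R : pzRingType) (M : lmodType R) (n : nat) : Prop :=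
  exists (F : nat -> lmodType R) (d : forall i, {linear F i.+1 -> F i})
      (e : {linear F 0%N -> M}),
    [/\ forall i, flat (F i),
        forall i, (n < i)%N -> forall x : F i, x = 0,
        forall y, exists x, e x = y,
        exact (d 0%N) e
      & forall i, exact (d i.+1) (d i)].

(* 0 -> M -> I^0 -> I^1 -> ... is exact, every I^i is injective, and every I^i  *)
(* is an injective envelope of the image of the preceding map.                  *)
Definition minimal_injective_resolution (R : pzRingType) (M : lmodType R)
    (I : nat -> lmodType R) (eta : {linear M -> I 0%N})
    (d : forall i, {linear I i -> I i.+1}) : Prop :=
  [/\ forall i, injective_module (I i),
      injective eta,
      exact eta (d 0%N) /\ forall i, exact (d i) (d i.+1),
      essential_image eta
    & forall i, essential_image (d i)].

(* Minimal injective resolutions exist and are unique up to isomorphism, so it  *)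
(* does not matter whether "a minimal injective resolution" is read as "some"   *)
(* or as "every"; "some" avoids any vacuity.                                    *)
Definition left_quasi_Gorenstein (R : pzRingType) (k : nat) : Prop :=
  exists (I : nat -> lmodType R) (eta : {linear R^o -> I 0%N})
      (d : forall i, {linear I i -> I i.+1}),
    minimal_injective_resolution eta d /\
    forall i, (i < k)%N -> flat_dim_le (I i) i.+1.

(* Theta is an isomorphism from A to Hom_R(A, R) as A-R-bimodules, where the    *)
(* bimodule structure on Hom_R(A, R) is (a h)(x) = h(x a), (h r)(x) = h(x) r.   *)
Definition frobenius_iso (R A : pzRingType) (f : {rmorphism R -> A})
    (Theta : A -> {linear left_restr f -> R^o}) : Prop :=
  [/\ forall (a b x : A), Theta (a + b) x = Theta a x + Theta b x,
      forall (a b x : A), Theta (a * b) x = Theta b (x * a : A),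
      forall (a x : A) (r : R), Theta (a * f r) x = (Theta a x : R) * r,
      forall a b, Theta a =1 Theta b -> a = b
    & forall h : {linear left_restr f -> R^o}, exists a, Theta a =1 h].

Definition Frobenius_extension (R A : pzRingType) (f : {rmorphism R -> A}) : Prop :=
  [/\ fin_gen (left_restr f), projective (left_restr f)
    & exists Theta : A -> {linear left_restr f -> R^o}, frobenius_iso Theta].

(* Main.v *)
Require Import Defs.
From HB Require Import structures.
From mathcomp Require Import all_boot all_algebra.
From mathcomp Require Import boolp classical_sets functions.

Set Implicit Arguments.
Unset Strict Implicit.
Unset Printing Implicit Defensive.

Import GRing.Theory.
Local Open Scope ring_scope.

(** Write theta for the Frobenius form, the R-R-bilinear map A -> R that
    corresponds to 1 under the isomorphism A = Hom_R(A, R).  Both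
    implications have the same shape: an injective resolution of one ring,
    moved along phi, becomes an injective resolution of a module over the other
    ring that has this other ring as a direct summand, and neither moving it
    nor cutting it down to a minimal resolution of the summand raises a flat
    dimension.

    Moving.  A dual basis for the form theta is a pair of families e, y with
      a = sum_i theta(a y_i) e_i = sum_i y_i theta(e_i a)   for all a in A.
    It identifies A (x)_R M with Hom_R(A, M), naturally in M, so that the left
    and the right adjoint of restriction of scalars coincide.  Coinduction
    M |-> Hom_R(A, M) is therefore exact and preserves injective as well as flat
    modules, and so does restriction ([injective_coind], [flat_coind],
    [injective_restr], [flat_restr]).  Coinduction turns a resolution of R into
    one of Hom_R(A, R) = A.  Restriction turns a resolution of A into one of A
    as an R-module, and R is a direct summand of A: by faithful flatness theta
    takes the value 1, say at c ([frobenius_form_unit]), and then r |-> r c is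
    split by theta.

    Cutting down.  If M0 is a direct summand of M, every injective resolution E
    of M contains a minimal injective resolution J of M0 with each J^n a direct
    summand of E^n ([minimal_resolution_of_retract]).  The induction keeps, for
    each n, a decomposition of the kernel of E^n -> E^(n+1) as M_n (+) K_n and
    spreads it to E^n = J^n (+) C^n with J^n an injective hull of M_n.

    Flat dimension.  It remains to see that a direct summand of a module has no
    larger flat dimension ([flat_dim_retract]).  This is a Schanuel argument:
    functorial free covers make the syzygy of the summand a summand of the
    syzygy, and syzygies in different flat modules are compared by means of
    the fact that the kernel of a surjection of flat modules is flat
    ([flat_kernel]). *)

(** * Submodules, kernels and retracts *)

Definition lin (R : pzRingType) (U V : lmodType R) (f : U -> V)
    (fL : linear f) : {linear U -> V} :=
  HB.pack f (GRing.isLinear.Build R U V *:%R f fL).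

Lemma submodule0 (R : pzRingType) (V : lmodType R) (P : V -> Prop) :
  submodule P -> P 0.
Proof. by case. Qed.

Lemma submoduleD (R : pzRingType) (V : lmodType R) (P : V -> Prop) u v :
  submodule P -> P u -> P v -> P (u + v).
Proof. by case=> _ H Pu Pv; rewrite -[u]scale1r; apply: H. Qed.

Lemma submoduleZ (R : pzRingType) (V : lmodType R) (P : V -> Prop) a u :
  submodule P -> P u -> P (a *: u).
Proof. by case=> P0 H Pu; rewrite -[a *: u]addr0; apply: H. Qed.

Lemma submoduleN (R : pzRingType) (V : lmodType R) (P : V -> Prop) u :
  submodule P -> P u -> P (- u).
Proof. by move=> HP; rewrite -scaleN1r; apply: submoduleZ. Qed.

Lemma submoduleB (R : pzRingType) (V : lmodType R) (P : V -> Prop) u v :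
  submodule P -> P u -> P v -> P (u - v).
Proof. by move=> HP Pu Pv; exact: submoduleD HP Pu (submoduleN HP Pv). Qed.

Section Submodule.
Variables (R : pzRingType) (V : lmodType R) (P : V -> Prop).
Hypothesis HP : submodule P.

(** The proof of closure is an argument, so that instance inference can recover
    it from the predicate. *)
Definition submod_pred of submodule P : {pred V} := fun v => `[< P v >].

Fact submod_pred_closed : GRing.submod_closed (submod_pred HP).
Proof.
case: (HP) => P0 PD; split; first exact/asboolP.
by move=> a u v /asboolP Pu /asboolP Pv; apply/asboolP/PD.
Qed.

HB.instance Definition _ :=
  GRing.isSubmodClosed.Build R V (submod_pred HP) submod_pred_closed.

Record submod_type :=
  SubmodType {submod_val : V; _ : submod_val \in submod_pred HP}.

HB.instance Definition _ := [isSub for submod_val].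
HB.instance Definition _ := [Choice of submod_type by <:].
HB.instance Definition _ := [SubChoice_isSubLmodule of submod_type by <:].

Definition submod : lmodType R := submod_type.

(** The inclusion is opaque, so that simplification keeps it folded. *)
Fact emb_sig : {f : {linear submod -> V} | f =1 val :> (submod_type -> V)}.
Proof. by exists (val : submod_type -> V). Qed.

Definition emb : {linear submod -> V} := sval emb_sig.

Lemma embE (x : submod) : emb x = val (x : submod_type).
Proof. exact: (svalP emb_sig). Qed.

Lemma emb_inj : injective emb.
Proof. by move=> x y; rewrite !embE => /val_inj. Qed.

Lemma emb_in (x : submod) : P (emb x).
Proof. by rewrite embE; case: x => x /= /asboolP. Qed.

Lemma emb_lift v : P v -> exists x : submod, emb x = v.
Proof.
move=> Pv; have Pv' : v \in submod_pred HP by exact/asboolP.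
by exists (SubmodType Pv'); rewrite embE.
Qed.

Lemma corestr (U : lmodType R) (f : {linear U -> V}) :
  (forall x, P (f x)) -> exists g : {linear U -> submod}, forall x, emb (g x) = f x.
Proof.
move=> Pf; have Pf' x : f x \in submod_pred HP by exact/asboolP.
have gL : linear (fun x => SubmodType (Pf' x) : submod).
  by move=> a u v; apply: val_inj; rewrite /= linearP.
by exists (lin gL) => x; rewrite embE.
Qed.

End Submodule.

Section Operations.
Variables (R : pzRingType) (U V : lmodType R) (f : {linear U -> V}).

Definition img (P : U -> Prop) (v : V) : Prop := exists2 u, P u & f u = v.

Lemma img_submodule P : submodule P -> submodule (img P).
Proof.
case=> P0 PD; split; first by exists 0; rewrite ?linear0.
move=> a _ _ [u Pu <-] [v Pv <-].
by exists (a *: u + v); [apply: PD | rewrite linearP].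
Qed.

Lemma ker_submodule : submodule (fun u => f u = 0).
Proof. by split=> [|a u v fu fv]; rewrite ?linear0 // linearP fu fv scaler0 addr0. Qed.

Lemma all_submodule : submodule (fun _ : U => True).
Proof. by []. Qed.

Lemma zero_submodule : submodule (fun u : U => u = 0).
Proof. by split=> // a u v -> ->; rewrite scaler0 addr0. Qed.

End Operations.

Definition retract (R : pzRingType) (M N : lmodType R) : Prop :=
  exists (i : {linear M -> N}) (p : {linear N -> M}), forall x, p (i x) = x.

Lemma injective_retract (R : pzRingType) (E F : lmodType R) :
  retract F E -> injective_module E -> injective_module F.
Proof.
move=> [i [p pi]] injE M N g h gI.
have [h' h'E] := injE _ _ g (i \o h) gI.
by exists (p \o h') => x /=; rewrite h'E /= pi.
Qed.

(** * Injective hulls and minimal resolutions *)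

Section Complements.
Variables (R : pzRingType) (E : lmodType R).
Implicit Types M K C : E -> Prop.

Definition meet0 M K := forall x, M x -> K x -> x = 0.

(** Zorn's lemma, applied to the submodules that contain [K] and avoid [M].
    The empty set is admitted as well, to bound the empty chain; it is not
    maximal because [K] is larger. *)
Lemma max_complement M K : submodule M -> submodule K -> meet0 M K ->
  exists C, [/\ submodule C, forall x, K x -> C x, meet0 M C &
    forall D, submodule D -> (forall x, C x -> D x) -> meet0 M D ->
      forall x, D x -> C x].
Proof.
move=> HM HK MK.
pose good C := [/\ submodule C, forall x, K x -> C x & meet0 M C].
have [|C [gC maxC]] := @Zorn_bigcup E (fun C => C = set0 \/ good C).
  move=> F FP totF.
  have [[X FX gX]|nogood] := pselect (exists2 X, F X & good X); last first.
    left; rewrite -subset0 => x [X FX Xx].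
    have [X0|gX] := FP _ FX; first by rewrite -X0.
    by case: nogood; exists X.
  have Fgood Y y : F Y -> Y y -> good Y.
    by move=> FY Yy; case: (FP _ FY) => // Y0; rewrite Y0 in Yy.
  right; split.
  - split; first by exists X => //; apply: submodule0; case: gX.
    move=> a u v [Y FY Yu] [Z FZ Zv].
    have [gY _ _] := Fgood _ _ FY Yu; have [gZ _ _] := Fgood _ _ FZ Zv.
    have [YZ|ZY] := totF _ _ FY FZ.
      by exists Z => //; case: gZ => _; apply=> //; apply: YZ.
    by exists Y => //; case: gY => _; apply=> //; apply: ZY.
  - by move=> x Kx; exists X => //; case: gX => _ + _; apply.
  - by move=> x Mx [Y FY Yx]; case: (Fgood _ _ FY Yx) => _ _; apply.
have {gC}gC : good C.
  case: gC => // C0; exfalso; apply: (maxC K); last by right; split.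
  by rewrite C0; split=> // /(_ _ (submodule0 HK)).
case: (gC) => HC KC MC; exists C; split=> // D HD CD MD x Dx.
apply: contrapT => nCx; apply: (maxC D).
  by split=> // DC; apply: nCx; apply: DC.
by right; split=> // y Ky; apply/CD/KC.
Qed.

(** The image of [psi] is an injective hull of [M] inside [E].  Let C be maximal
    among the submodules that contain [K] and avoid [M], and J maximal among
    those that contain [M] and avoid C.  Maximality of C makes [M] essential
    in J.  The projection J (+) C -> J extends to an endomorphism [psi] of [E];
    its kernel is C by maximality of C, hence its image avoids C, and is J by
    maximality of J.  Two complements replace the usual passage to a maximal
    essential extension, which would need the quotient E/C. *)
Lemma hull_projection M K : injective_module E ->
    submodule M -> submodule K -> meet0 M K ->
  exists psi : {linear E -> E},
    [/\ forall x, psi (psi x) = psi x, forall x, M x -> psi x = x,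
      forall x, K x -> psi x = 0 &
      forall U, submodule U -> (forall x, U x -> psi x = x) -> meet0 M U ->
        forall x, U x -> x = 0].
Proof.
move=> injE HM HK MK.
have [C [HC KC MC maxC]] := max_complement HM HK MK.
have CM : meet0 C M by move=> x Cx Mx; apply: (MC).
have [J [HJ MJ CJ maxJ]] := max_complement HC HM CM.
have essJ U : submodule U -> (forall x, U x -> J x) -> meet0 M U ->
    forall x, U x -> x = 0.
  (* C + U still avoids M, so U lies in C as well as in J. *)
  move=> HU UJ MU x Ux.
  pose D y := exists u c, [/\ U u, C c & y = u + c].
  apply: (CJ); last exact: UJ.
  apply: (maxC D); last 1 first.
  - by exists x, 0; rewrite addr0; split=> //; apply: submodule0.
  - split; first by exists 0, 0; rewrite addr0; split=> //; apply: submodule0.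
    move=> a _ _ [u [c [Uu Cc ->]]] [u' [c' [Uu' Cc' ->]]].
    exists (a *: u + u'), (a *: c + c'); split.
    + by case: HU => _; apply.
    + by case: HC => _; apply.
    by rewrite scalerDr addrACA.
  - by move=> y Cy; exists 0, y; rewrite add0r; split=> //; apply: submodule0.
  move=> y My [u [c [Uu Cc yE]]].
  have c0 : c = 0.
    apply: (CJ) => //; have -> : c = y - u by rewrite yE addrC addKr.
    by apply: submoduleB => //; [apply: (MJ) | apply: (UJ)].
  by apply: (MU) => //; rewrite yE c0 addr0.
pose JC : lmodType R := (submod HJ * submod HC)%type.
pose s0 (z : JC) : E := emb HJ z.1 + emb HC z.2.
have sL : linear s0 by move=> a z w; rewrite /s0 /= !linearP scalerDr addrACA.
pose p0 (z : JC) : E := emb HJ z.1.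
have pL : linear p0 by move=> a z w; rewrite /p0 /= !linearP.
have sI : injective (lin sL).
  have s00 z : s0 z = 0 -> z = 0.
    case: z => z w; rewrite /s0 /= => /eqP; rewrite addr_eq0 => /eqP zw.
    have w0 : emb HC w = 0.
      apply: (CJ); first exact: emb_in.
      rewrite -[X in J X]opprK -zw; apply: submoduleN => //; exact: emb_in.
    congr pair; first by apply: (@emb_inj _ _ _ HJ); rewrite zw w0 oppr0 linear0.
    by apply: (@emb_inj _ _ _ HC); rewrite w0 linear0.
  move=> z w /= zw; apply/eqP; rewrite -subr_eq0; apply/eqP/s00.
  by rewrite -[s0 _]/(lin sL (z - w)) linearB /= zw subrr.
have [psi psiE] := injE _ _ (lin sL) (lin pL) sI.
have psiJ x : J x -> psi x = x.
  move=> Jx; have [z zE] := emb_lift HJ Jx.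
  by have := psiE (z, 0); rewrite /= /s0 /p0 /= linear0 addr0 zE.
have psiC x : C x -> psi x = 0.
  move=> Cx; have [z zE] := emb_lift HC Cx.
  by have := psiE (0, z); rewrite /= /s0 /p0 /= linear0 add0r zE.
(* The kernel contains C and avoids M. *)
have kerC x : psi x = 0 -> C x.
  apply: (maxC (fun x => psi x = 0)); [exact: ker_submodule | exact: psiC |].
  by move=> y My <-; rewrite psiJ //; apply: (MJ).
(* The image contains J; it avoids C, as follows.  If y = psi z is in C and z is
   not, then C + Rz meets M in some m = a z + c with m <> 0, and
   m = psi m = a y lies in C, a contradiction. *)
have imJ x : J (psi x).
  apply: (maxJ (img psi (fun _ => True))); last by exists x.
  - exact/img_submodule/all_submodule.
  - by move=> y Jy; exists y => //; apply: psiJ.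
  move=> y Cy [z _ zE]; rewrite -zE; apply: contrapT => nz.
  have nCz : ~ C z by move=> /psiC.
  pose D y := exists a c, C c /\ y = a *: z + c.
  apply: nCz; apply: (maxC D); last 1 first.
  - by exists 1, 0; rewrite scale1r addr0; split=> //; apply: submodule0.
  - split; first by exists 0, 0; rewrite scale0r addr0; split=> //; apply: submodule0.
    move=> b _ _ [a [c [Cc ->]]] [a' [c' [Cc' ->]]].
    exists (b * a + a'), (b *: c + c'); split; first by case: (HC) => _; apply.
    by rewrite scalerDr scalerDl addrACA scalerA.
  - by move=> v Cv; exists 0, v; rewrite scale0r add0r.
  move=> m Mm [a [c [Cc mE]]]; apply: (CM) => //.
  have : psi m = a *: y by rewrite mE linearP zE psiC // addr0.
  by rewrite (psiJ _ (MJ _ Mm)) => ->; apply: submoduleZ.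
exists psi; split.
- by move=> x; apply: psiJ.
- by move=> x Mx; apply/psiJ/MJ.
- by move=> x Kx; apply/psiC/KC.
- by move=> U HU UJ; apply: essJ => // x /UJ <-.
Qed.

End Complements.

Definition injective_resolution (R : pzRingType) (M : lmodType R)
    (E : nat -> lmodType R) (eta : {linear M -> E 0%N})
    (d : forall i, {linear E i -> E i.+1}) : Prop :=
  [/\ forall i, injective_module (E i), injective eta, exact eta (d 0%N)
    & forall i, exact (d i) (d i.+1)].

(** Start from ker d_0 = N = M_0 (+) K_0 with M_0 a copy of [M].  Given
    ker d_n = M_n (+) K_n, [hull_projection] gives E_n = J_n (+) C_n with
    M_n essential in J_n and K_n inside C_n.  The image of d_n, which is
    ker d_(n+1), is then the direct sum of M_(n+1) = d_n(J_n) and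
    K_(n+1) = d_n(C_n), and the kernel of d_n on J_n is M_n.  Hence the J_n with
    the restricted maps form a minimal resolution of M_0. *)
Lemma minimal_resolution_of_retract (R : pzRingType) (M N : lmodType R)
    (E : nat -> lmodType R) (eta : {linear N -> E 0%N})
    (d : forall i, {linear E i -> E i.+1}) :
    retract M N -> injective_resolution eta d ->
  exists (J : nat -> lmodType R) (eta' : {linear M -> J 0%N})
      (d' : forall i, {linear J i -> J i.+1}),
    minimal_injective_resolution eta' d' /\ forall i, retract (J i) (E i).
Proof.
move=> [i [p pi]] [injE etaI ex0 exS].
pose hullP i (MK : (E i -> Prop) * (E i -> Prop)) (psi : {linear E i -> E i}) :=
  [/\ forall x, psi (psi x) = psi x, forall x, MK.1 x -> psi x = x,
      forall x, MK.2 x -> psi x = 0 &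
      forall U, submodule U -> (forall x, U x -> psi x = x) -> meet0 MK.1 U ->
        forall x, U x -> x = 0].
(* By [goodP] the recursion only meets pairs for which a projection exists. *)
pose hull n MK : {linear E n -> E n} :=
  if pselect (exists psi, hullP n MK psi) is left ex then sval (cid ex)
  else (idfun : {linear E n -> E n}).
pose MK := fix MK n : (E n -> Prop) * (E n -> Prop) :=
  if n is m.+1 return (E n -> Prop) * (E n -> Prop) then
    (img (d m) (fun x => hull m (MK m) x = x),
     img (d m) (fun x => hull m (MK m) x = 0))
  else (img (eta \o i) (fun _ => True), img eta (fun x => p x = 0)).
pose psi n := hull n (MK n).
pose good n := [/\ submodule (MK n).1 /\ submodule (MK n).2, meet0 (MK n).1 (MK n).2,
  (forall x, (MK n).1 x -> d n x = 0) /\ (forall x, (MK n).2 x -> d n x = 0) &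
  forall x, d n x = 0 -> exists m k, [/\ (MK n).1 m, (MK n).2 k & x = m + k]].
have psiP n : good n -> hullP n (MK n) (psi n).
  move=> [[HM HK] MK0 _ _]; have exf := hull_projection (injE n) HM HK MK0.
  by rewrite /psi /hull; case: pselect => // ex; case: (cid ex).
have fix_submodule n : submodule (fun x => psi n x = x).
  by split=> [|a u v fu fv]; rewrite ?linear0 // linearP fu fv.
(* In the step, d j = d c with j in J and c in C makes c - j = m + k; applying
   psi gives m = - j, whence d j = 0. *)
have goodP n : good n.
  elim: n => [|n IHn].
    split.
    - split; apply: img_submodule; first exact: all_submodule.
      exact: ker_submodule.
    - move=> _ [m _ <-] [k pk /= /etaI km].
      by move: pk; rewrite km pi => ->; rewrite !linear0.
    - by split=> _ [m _ <-]; apply/ex0; [exists (i m) | exists m].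
    move=> x /ex0 [y <-]; exists (eta (i (p y))), (eta (y - i (p y))); split.
    - by exists (p y).
    - by exists (y - i (p y)); rewrite // linearB pi subrr.
    by rewrite -linearD addrC subrK.
  have [psi2 psiM psiK _] := psiP n IHn.
  case: IHn => [[HM HK] _ [dM dK] dMK]; split.
  - by split; apply: img_submodule; [apply: fix_submodule | apply: ker_submodule].
  - move=> x [j /= jJ <-] [c /= cC /eqP]; rewrite -subr_eq0 -linearB => /eqP/dMK.
    move=> [m [k [Mm Kk cjE]]]; have: psi n (c - j) = psi n (m + k) by rewrite cjE.
    rewrite linearB linearD [psi n c]cC [psi n j]jJ psiM // psiK // addr0 sub0r.
    by move=> jm; apply: oppr_inj; rewrite -linearN jm dM // oppr0.
  - by split=> _ [m _ <-]; apply/exS; exists m.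
  move=> x /exS [y <-]; exists (d n (psi n y)), (d n (y - psi n y)); split.
  - by exists (psi n y).
  - by exists (y - psi n y) => //; rewrite -/(psi n) linearB psi2 subrr.
  by rewrite -linearD addrC subrK.
pose J n := submod (fix_submodule n).
have inc_inj n := @emb_inj _ _ _ (fix_submodule n).
have psi2 n : forall x, psi n (psi n x) = psi n x by case: (psiP n (goodP n)).
have MJ n x : (MK n).1 x -> psi n x = x by case: (psiP n (goodP n)) => _ + _ _; apply.
have J_fix n (x : J n) : psi n (emb (fix_submodule n) x) = emb (fix_submodule n) x.
  exact: (@emb_in _ _ _ (fix_submodule n) x).
have J_ker n x : psi n x = x -> d n x = 0 -> (MK n).1 x.
  case: (psiP n (goodP n)) => _ psiM psiK _; case: (goodP n) => _ _ _ dMK xJ /dMK.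
  move=> [m [k [Mm Kk xE]]].
  by rewrite -xJ xE linearD psiM // psiK // addr0.
have essJ n (U : J n -> Prop) : submodule U ->
    (forall u, U u -> (MK n).1 (emb (fix_submodule n) u) -> u = 0) ->
    forall u, U u -> u = 0.
  move=> HU MU u Uu; case: (psiP n (goodP n)) => _ _ _ ess.
  apply: (inc_inj n); rewrite linear0.
  apply: (ess (img (emb (fix_submodule n)) U)); last by exists u.
  - exact: img_submodule.
  - by move=> _ [v _ <-]; apply: J_fix.
  by move=> x Mx [v Uv vx]; rewrite -vx in Mx *; rewrite (MU v) ?linear0.
have [eta' eta'E] := corestr (fix_submodule 0%N) (f := eta \o i)
  (fun x => MJ 0%N _ (ex_intro2 _ _ x I erefl)).
have ex_d' n : {d' : {linear J n -> J n.+1} | forall x,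
    emb (fix_submodule n.+1) (d' x) = d n (emb (fix_submodule n) x)}.
  apply/cid/(corestr _ (f := d n \o emb (fix_submodule n))) => x.
  by apply: (MJ n.+1); exists (emb (fix_submodule n) x) => //; apply: J_fix.
pose d' n := sval (ex_d' n).
have d'E n x : emb (fix_submodule n.+1) (d' n x) = d n (emb (fix_submodule n) x).
  exact: svalP (ex_d' n) x.
have d'0 n x : d' n x = 0 <-> d n (emb (fix_submodule n) x) = 0.
  split=> dx0; first by rewrite -d'E dx0 linear0.
  by apply: (inc_inj n.+1); rewrite d'E dx0 linear0.
have retJ n : retract (J n) (E n).
  have [q qE] := corestr (fix_submodule n) (f := psi n) (psi2 n).
  exists (emb (fix_submodule n)), q => x.
  by apply: (inc_inj n); rewrite qE J_fix.
exists J, eta', d'; split=> //; split.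
- by move=> n; apply: injective_retract (retJ n) (injE n).
- move=> x y /(congr1 (emb (fix_submodule 0%N))); rewrite !eta'E /= => /etaI.
  by move/(congr1 p); rewrite !pi.
- split=> [y|n y]; rewrite d'0.
    split=> [/(J_ker 0%N _ (J_fix 0%N y)) [x _ xE]|[x <-]].
      by exists x; apply: (inc_inj 0%N); rewrite eta'E.
    by rewrite eta'E; apply/ex0; exists (i x).
  split=> [/(J_ker n.+1 _ (J_fix n.+1 y)) [x xJ xE]|[x <-]]; last first.
    by rewrite d'E; apply/exS; exists (emb (fix_submodule n) x).
  have [z zE] := emb_lift (fix_submodule n) xJ.
  by exists z; apply: (inc_inj n.+1); rewrite d'E zE.
- move=> U HU Ueta; apply: essJ => // u Uu [x _ xE].
  have ux : u = eta' x.
    by apply: (inc_inj 0%N); rewrite eta'E.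
  by rewrite ux in Uu *; apply: Ueta.
move=> n U HU Ud; apply: essJ => // u Uu [x xJ xE].
have [z zE] := emb_lift (fix_submodule n) xJ.
have uz : u = d' n z.
  by apply: (inc_inj n.+1); rewrite d'E zE.
by rewrite uz in Uu *; apply: Ud.
Qed.

(** * Pure tensors and right exactness of the tensor product *)

Notation lid M := (idfun : {linear M -> M}).

Lemma morphD_zmod (U V : zmodType) (f : U -> V) :
  {morph f : x y / x + y} -> zmod_morphism f.
Proof. by move=> fD x y; apply: (addIr (f y)); rewrite -fD !subrK. Qed.

Definition addm (U V : zmodType) (f : U -> V) (fD : {morph f : x y / x + y}) :
    {additive U -> V} :=
  HB.pack f (GRing.isZmodMorphism.Build U V f (morphD_zmod fD)).

Section Pure.
Variables (R : pzRingType) (N : lmodType R^c) (M : lmodType R).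

Definition pure (x : N) (y : M) : tensor N M := tclass [:: (x, y)].

Lemma tclassD s t : tclass (s ++ t) = tclass s + tclass t :> tensor N M.
Proof. by rewrite -tadd_class. Qed.

Lemma pureDl y : {morph pure^~ y : x x' / x + x'}.
Proof. by move=> x x'; rewrite -tclassD; apply/tclassP/TRaddl. Qed.

Lemma pureDr x : {morph pure x : y y' / y + y'}.
Proof. by move=> y y'; rewrite -tclassD; apply/tclassP/TRaddr. Qed.

Lemma pureZ (r : R) x y : pure ((r : R^c) *: x) y = pure x (r *: y).
Proof. exact/tclassP/TRbal. Qed.

Lemma pure0l y : pure 0 y = 0. Proof. exact: raddf0 (addm (pureDl y)). Qed.
Lemma pure0r x : pure x 0 = 0. Proof. exact: raddf0 (addm (pureDr x)). Qed.

Lemma pureBr x y y' : pure x (y - y') = pure x y - pure x y'.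
Proof. exact: (raddfB (addm (pureDr x))). Qed.

Lemma pure_suml I (s : seq I) (F : I -> N) y :
  pure (\sum_(i <- s) F i) y = \sum_(i <- s) pure (F i) y.
Proof. exact: (raddf_sum (addm (pureDl y))). Qed.

Lemma pure_sumr I (s : seq I) (F : I -> M) x :
  pure x (\sum_(i <- s) F i) = \sum_(i <- s) pure x (F i).
Proof. exact: (raddf_sum (addm (pureDr x))). Qed.

Lemma tclassE s : tclass s = \sum_(p <- s) pure p.1 p.2.
Proof.
elim: s => [|[x y] s IHs]; first by rewrite big_nil.
by rewrite big_cons -IHs /pure -tclassD.
Qed.

Lemma tensor_ind (P : tensor N M -> Prop) :
  P 0 -> (forall x y u, P u -> P (pure x y + u)) -> forall u, P u.
Proof.
move=> P0 PD u; rewrite -(treprK u) tclassE.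
by elim: (trepr u) => [|p s IHs]; rewrite ?big_nil // big_cons; apply: PD.
Qed.

End Pure.

Section TensorMaps.
Variable R : pzRingType.
Implicit Types (N : lmodType R^c) (M : lmodType R).

Lemma tensor_mapD N N' M M' (g : {linear N -> N'}) (h : {linear M -> M'}) :
  {morph tensor_map g h : u v / u + v}.
Proof.
move=> u v; rewrite -(treprK u) -(treprK v) -tclassD !tensor_map_class.
by rewrite map_cat tclassD.
Qed.

Definition tmap N N' M M' (g : {linear N -> N'}) (h : {linear M -> M'}) :
  {additive tensor N M -> tensor N' M'} := addm (tensor_mapD g h).

Lemma tmap_pure N N' M M' (g : {linear N -> N'}) (h : {linear M -> M'}) x y :
  tmap g h (pure x y) = pure (g x) (h y).
Proof. by rewrite /= tensor_map_class. Qed.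

Lemma tmap_swap N N' M M' (g : {linear N -> N'}) (h : {linear M -> M'}) u :
  tmap g (lid _) (tmap (lid _) h u) = tmap (lid _) h (tmap g (lid _) u).
Proof.
elim/tensor_ind: u => [|x y u IHu]; first by rewrite !raddf0.
by rewrite !raddfD IHu !tmap_pure.
Qed.

Lemma tmap_surj N N' M M' (g : {linear N -> N'}) (h : {linear M -> M'}) :
  (forall y, exists x, g x = y) -> (forall y, exists x, h x = y) ->
  forall u, exists v, tmap g h v = u.
Proof.
move=> gS hS; elim/tensor_ind => [|y z u [v <-]]; first by exists 0; rewrite raddf0.
have [x <-] := gS y; have [w <-] := hS z.
by exists (pure x w + v); rewrite raddfD tmap_pure.
Qed.

Lemma tmapl_comp0 N1 N2 N3 M (g : {linear N1 -> N2}) (h : {linear N2 -> N3}) u :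
  (forall x, h (g x) = 0) -> tmap h (lid M) (tmap g (lid M) u) = 0.
Proof.
move=> hg; elim/tensor_ind: u => [|x y u IHu]; first by rewrite !raddf0.
by rewrite !raddfD IHu !tmap_pure hg pure0l addr0.
Qed.

Lemma tmapr_comp0 N M1 M2 M3 (g : {linear M1 -> M2}) (h : {linear M2 -> M3}) u :
  (forall x, h (g x) = 0) -> tmap (lid N) h (tmap (lid N) g u) = 0.
Proof.
move=> hg; elim/tensor_ind: u => [|x y u IHu]; first by rewrite !raddf0.
by rewrite !raddfD IHu !tmap_pure hg pure0r addr0.
Qed.

(** Choose a set-theoretic section of [q] and apply it to the right factors of a
    formal sum.  Each generating relation of the tensor product then holds up to
    the image of [i], because the section is additive and [R]-linear up to
    ker q; so the construction inverts [q] modulo that image. *)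
Lemma tensor_right_exact N (K G F : lmodType R)
    (i : {linear K -> G}) (q : {linear G -> F}) :
  exact i q -> (forall y, exists x, q x = y) ->
  forall u : tensor N G, tmap (lid N) q u = 0 -> exists w, tmap (lid N) i w = u.
Proof.
move=> iq qS; pose im u := exists w, tmap (lid N) i w = u.
have imD u v : im u -> im v -> im (u + v).
  by move=> [w <-] [w' <-]; exists (w + w'); rewrite raddfD.
have imN u : im u -> im (- u) by move=> [w <-]; exists (- w); rewrite raddfN.
have im_pure x y : q y = 0 -> im (pure x y).
  by move=> /iq [k <-]; exists (pure x k); rewrite tmap_pure.
have [sec secE] := choice qS.
pose B (s : seq (N * F)) : tensor N G := \sum_(p <- s) pure p.1 (sec p.2).
have B1 p : B [:: p] = pure p.1 (sec p.2) by rewrite /B big_seq1.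
have B2 p p' : B [:: p; p'] = pure p.1 (sec p.2) + pure p'.1 (sec p'.2).
  by rewrite /B big_cons big_seq1.
have BD s t : B (s ++ t) = B s + B t by rewrite /B big_cat.
have Brel s t : tensor_rel s t -> im (B s - B t).
  elim=> {s t}.
  - by move=> s; rewrite subrr; exists 0; rewrite raddf0.
  - by move=> s t _ /imN; rewrite opprB.
  - by move=> t s u _ st _ tu; rewrite -(subrK (B t) (B s)) -addrA; apply: imD.
  - by move=> s s' t t' _ ss' _ tt'; rewrite !BD opprD addrACA; apply: imD.
  - by move=> s t; rewrite !BD [B t + _]addrC subrr; exists 0; rewrite raddf0.
  - move=> x x' y; rewrite B1 B2 /= pureDl subrr.
    by exists 0; rewrite raddf0.
  - move=> x y y'; rewrite B1 B2 /= -pureDr -pureBr.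
    by apply: im_pure; rewrite linearB linearD !secE subrr.
  - by move=> y; rewrite B1 /B big_nil /= pure0l subrr; exists 0; rewrite raddf0.
  - move=> r x y; rewrite !B1 /= pureZ -pureBr.
    by apply: im_pure; rewrite linearB linearZ !secE subrr.
move=> u; rewrite -(treprK u); move: (trepr u) => s.
rewrite /= tensor_map_class => /tclassP/Brel.
rewrite {2}/B big_nil subr0 /B big_map => imB.
have: im (tclass s - \sum_(p <- s) pure p.1 (sec (q p.2))).
  rewrite tclassE -sumrB; elim: s {imB} => [|p s IHs].
    by rewrite big_nil; exists 0; rewrite raddf0.
  rewrite big_cons; apply: imD => //; rewrite -pureBr.
  by apply: im_pure; rewrite linearB secE subrr.
by move=> /imD/(_ imB); rewrite subrK.
Qed.

End TensorMaps.

Notation ker f := (submod (ker_submodule f)).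
Notation ker_emb f := (emb (ker_submodule f)).

Section Kernels.
Variables (R : pzRingType) (U V : lmodType R) (f : {linear U -> V}).

Lemma ker_embK x : f (ker_emb f x) = 0.
Proof. exact: (@emb_in _ _ _ (ker_submodule f) x). Qed.

Lemma ker_emb_inj : injective (ker_emb f). Proof. exact: emb_inj. Qed.

Lemma exact_ker_emb : exact (ker_emb f) f.
Proof.
by move=> y; split=> [fy|[x <-]]; [exact: emb_lift fy | exact: ker_embK].
Qed.

End Kernels.

(** Exactness of 0 -> N1 -> N2, with the zero map as an endomorphism of [N1]. *)
Lemma flat_inj (R : pzRingType) (F : lmodType R) (N1 N2 : lmodType R^c)
    (g : {linear N1 -> N2}) :
  flat F -> injective g -> forall u, tmap g (lid F) u = 0 -> u = 0.
Proof.
move=> fF gI u gu.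
have ex : exact (\0 : {linear N1 -> N1}) g.
  by move=> y; split=> [gy|[x <-]]; [exists 0; apply: gI|]; rewrite ?gy linear0.
have [v <-] := (fF _ _ _ _ _ ex u).1 gu.
rewrite -[LHS]/(tmap \0 (lid F) v).
elim/tensor_ind: v => [|x y v IHv]; first by rewrite raddf0.
by rewrite raddfD IHv tmap_pure pure0l addr0.
Qed.

(** * Free modules *)

Section FreeModule.
Variables (R : pzRingType) (T : choiceType).

Definition finite_support (f : T -> R^o) : Prop :=
  exists s : seq T, forall t, t \notin s -> f t = 0.

Fact finite_support_submodule : submodule finite_support.
Proof.
split=> [|a f g [s sf] [s' sg]]; first by exists [::].
exists (s ++ s') => t; rewrite mem_cat negb_or => /andP [ts ts'].
have -> : (a *: f + g) t = a *: f t + g t by [].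
by rewrite sf // sg // scaler0 addr0.
Qed.

Definition freemod : lmodType R := submod finite_support_submodule.

Fact eval_linear t : linear (fun f : freemod => emb finite_support_submodule f t).
Proof. by move=> a f g; rewrite linearP. Qed.

Definition eval t : {linear freemod -> R^o} := lin (eval_linear t).

Lemma freemod_eq (f g : freemod) : (forall t, eval t f = eval t g) -> f = g.
Proof.
by move=> fg; apply: (@emb_inj _ _ _ finite_support_submodule); apply/funext.
Qed.

Fact basis_sig (t : T) : {b : freemod | forall t', eval t' b = (t' == t)%:R}.
Proof.
apply/cid.
have [|b bE] := emb_lift finite_support_submodule (v := fun t' => (t' == t)%:R : R^o).
  by exists [:: t] => t'; rewrite inE => /negPf ->.
by exists b => t'; rewrite /= bE.
Qed.

Definition basis t : freemod := sval (basis_sig t).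

Lemma eval_basis t t' : eval t' (basis t) = (t' == t)%:R.
Proof. exact: svalP (basis_sig t) t'. Qed.

Definition supports (s : seq T) (f : freemod) := forall t, t \notin s -> eval t f = 0.

Fact support_sig (f : freemod) : {s | uniq s & supports s f}.
Proof.
apply/cid2; have [s sf] := @emb_in _ _ _ finite_support_submodule f.
by exists (undup s); rewrite ?undup_uniq // => t; rewrite mem_undup; apply: sf.
Qed.

Definition support (f : freemod) : seq T := s2val (support_sig f).

Lemma support_uniq f : uniq (support f). Proof. exact: (s2valP (support_sig f)). Qed.
Lemma supportP f : supports (support f) f. Proof. exact: (s2valP' (support_sig f)). Qed.

Lemma sum_supports (G : nmodType) (F : T -> G) s s' : uniq s -> uniq s' ->
    (forall t, t \notin s -> F t = 0) -> (forall t, t \notin s' -> F t = 0) ->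
  \sum_(t <- s) F t = \sum_(t <- s') F t.
Proof.
move=> us us' sF s'F.
have restrict (r r' : seq T) : (forall t, t \notin r' -> F t = 0) ->
    \sum_(t <- r) F t = \sum_(t <- r | t \in r') F t.
  move=> r'F; rewrite (bigID (mem r')) /= [X in _ + X]big1 ?addr0 //.
rewrite (restrict s s') // (restrict s' s) // -big_filter -[RHS]big_filter.
apply/perm_big/uniq_perm; rewrite ?filter_uniq // => t.
by rewrite !mem_filter andbC.
Qed.

Lemma freemod_sum s f : uniq s -> supports s f ->
  f = \sum_(t <- s) (eval t f : R) *: basis t.
Proof.
move=> us sf; apply: freemod_eq => t; rewrite linear_sum.
have scaleE t' : eval t ((eval t' f : R) *: basis t') = if t' == t then eval t f else 0.
  rewrite linearZ eval_basis [t == _]eq_sym; case: eqP => [->|_].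
    exact: mulr1.
  exact: mulr0.
under eq_bigr do rewrite scaleE.
rewrite -big_mkcond; have [ts|/[dup] ts /sf ->] := boolP (t \in s).
  by rewrite -big_filter filter_pred1_uniq // big_seq1.
by rewrite big1.
Qed.

Section Extension.
Variables (V : lmodType R) (v : T -> V).

Let ext (f : freemod) : V := \sum_(t <- support f) (eval t f : R) *: v t.

Let extE s f : uniq s -> supports s f ->
  ext f = \sum_(t <- s) (eval t f : R) *: v t.
Proof.
move=> us sf; apply: sum_supports; first exact: support_uniq.
- by [].
- by move=> t ts; rewrite (supportP ts) scale0r.
- by move=> t ts; rewrite (sf t ts) scale0r.
Qed.

Fact ext_linear : linear ext.
Proof.
move=> a f g; pose s := undup (support f ++ support g ++ support (a *: f + g)).
have us : uniq s by apply: undup_uniq.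
have sub h : {subset support h <= s} -> supports s h.
  by move=> hs t ts; apply: supportP; apply: contra ts; apply: hs.
rewrite !(extE us); first last.
- by apply: sub => t ts; rewrite mem_undup !mem_cat ts !orbT.
- by apply: sub => t ts; rewrite mem_undup !mem_cat ts.
- by apply: sub => t ts; rewrite mem_undup !mem_cat ts orbT.
rewrite scaler_sumr -big_split; apply: eq_bigr => t _.
by rewrite linearP /= scalerDl scalerA.
Qed.

Fact freemod_ext_sig : {h : {linear freemod -> V} | forall t, h (basis t) = v t}.
Proof.
exists (lin ext_linear) => t; rewrite /= (@extE [:: t]) //; last first.
  by move=> t'; rewrite inE eval_basis => /negPf ->.
by rewrite big_seq1 eval_basis eqxx scale1r.
Qed.

Definition freemod_ext : {linear freemod -> V} := sval freemod_ext_sig.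

Lemma freemod_extE t : freemod_ext (basis t) = v t.
Proof. exact: svalP freemod_ext_sig t. Qed.

End Extension.

Lemma freemod_map_eq (V : lmodType R) (f g : {linear freemod -> V}) :
  (forall t, f (basis t) = g (basis t)) -> f =1 g.
Proof.
move=> fg x; rewrite (freemod_sum (support_uniq x) (@supportP x)) !linear_sum.
by apply: eq_bigr => t _; rewrite !linearZ fg.
Qed.

End FreeModule.

Arguments eval {R T} t.

(** An element of N (x) R^(T) is determined by its coordinates in N, which are
    natural in N; this reduces exactness to that of N itself. *)
Section TensorFree.
Variables (R : pzRingType) (T : choiceType).

Section Left.
Variable N : lmodType R^c.

Fact coordl_exists t : exists h : {additive tensor N (freemod R T) -> N},
  forall x (f : freemod R T), h (pure x f) = (eval t f : R^c) *: x.
Proof.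
apply: (tensor_universal (b := fun x f => (eval t f : R^c) *: x)) => [x x' f|x f g|r x f].
- exact: scalerDr.
- by rewrite linearD; exact: scalerDl.
- by rewrite scalerA linearZ.
Qed.

Definition coordl t := sval (cid (coordl_exists t)).

Lemma coordl_pure t x (f : freemod R T) : coordl t (pure x f) = (eval t f : R^c) *: x.
Proof. exact: (svalP (cid (coordl_exists t))). Qed.

Lemma coordl_sum u : exists s, u = \sum_(t <- s) pure (coordl t u) (basis R t).
Proof.
suff [s sP] : exists s : seq T, forall s', uniq s' -> {subset s <= s'} ->
    u = \sum_(t <- s') pure (coordl t u) (basis R t).
  exists (undup s); apply: (sP _ (undup_uniq s)) => t.
  by rewrite mem_undup.
elim/tensor_ind: u => [|x f u [s sP]].
  by exists [::] => s' _ _; rewrite big1 // => t _; rewrite raddf0 pure0l.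
exists (support f ++ s) => s' us' ss'.
under eq_bigr do rewrite raddfD pureDl.
rewrite big_split -sP //=; last by move=> t ts; apply: ss'; rewrite mem_cat ts orbT.
have sf : supports s' f.
  move=> t ts; apply: supportP; apply: contra ts => ts; apply: ss'.
  by rewrite mem_cat ts.
congr (_ + _); rewrite [in LHS](freemod_sum us' sf) pure_sumr; apply: eq_bigr => t _.
by rewrite coordl_pure pureZ.
Qed.

End Left.

Arguments coordl {N} t.

Lemma coordl_natural (N N' : lmodType R^c) (g : {linear N -> N'}) t u :
  coordl t (tmap g (lid (freemod R T)) u) = g (coordl t u).
Proof.
elim/tensor_ind: u => [|x f u IHu]; first by rewrite !raddf0.
rewrite !raddfD IHu tmap_pure !coordl_pure; congr (_ + _).
exact/esym/(linearZ_LR g).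
Qed.

Lemma flat_freemod : flat (freemod R T).
Proof.
move=> N1 N2 N3 g h gh u; split=> [hu|[v <-]]; last first.
  by apply: tmapl_comp0 => x; apply/gh; exists x.
have lift t : exists x, g x = coordl t u.
  by apply/gh; rewrite -coordl_natural /= hu raddf0.
have [x xE] := choice lift; have [s ->] := coordl_sum u.
exists (\sum_(t <- s) pure (x t) (basis R t)).
rewrite -[LHS]/(tmap g (lid _) _) raddf_sum; apply: eq_bigr => t _.
by rewrite tmap_pure xE.
Qed.

End TensorFree.

(** The same coordinates with the free module on the right-module side. *)
Section TensorFreeRight.
Variables (R : pzRingType) (T : choiceType).

Section Right.
Variable M : lmodType R.

Fact coordr_exists t : exists h : {additive tensor (freemod R^c T) M -> M},
  forall (f : freemod R^c T) y, h (pure f y) = (eval t f : R) *: y.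
Proof.
apply: (tensor_universal (b := fun f y => (eval t f : R) *: y)) => [f g y|f y y'|r f y].
- by rewrite linearD; exact: scalerDl.
- exact: scalerDr.
- by rewrite scalerA linearZ.
Qed.

Definition coordr t := sval (cid (coordr_exists t)).

Lemma coordr_pure t (f : freemod R^c T) y : coordr t (pure f y) = (eval t f : R) *: y.
Proof. exact: (svalP (cid (coordr_exists t))). Qed.

Lemma coordr_sum u : exists s, u = \sum_(t <- s) pure (basis R^c t) (coordr t u).
Proof.
suff [s sP] : exists s : seq T, forall s', uniq s' -> {subset s <= s'} ->
    u = \sum_(t <- s') pure (basis R^c t) (coordr t u).
  exists (undup s); apply: (sP _ (undup_uniq s)) => t.
  by rewrite mem_undup.
elim/tensor_ind: u => [|f y u [s sP]].
  by exists [::] => s' _ _; rewrite big1 // => t _; rewrite raddf0 pure0r.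
exists (support f ++ s) => s' us' ss'.
under eq_bigr do rewrite raddfD pureDr.
rewrite big_split -sP //=; last by move=> t ts; apply: ss'; rewrite mem_cat ts orbT.
have sf : supports s' f.
  move=> t ts; apply: supportP; apply: contra ts => ts; apply: ss'.
  by rewrite mem_cat ts.
congr (_ + _); rewrite [in LHS](freemod_sum us' sf) pure_suml; apply: eq_bigr => t _.
by rewrite coordr_pure pureZ.
Qed.

End Right.

Arguments coordr {M} t.

Lemma coordr_natural (M M' : lmodType R) (h : {linear M -> M'}) t u :
  coordr t (tmap (lid (freemod R^c T)) h u) = h (coordr t u).
Proof.
elim/tensor_ind: u => [|f y u IHu]; first by rewrite !raddf0.
rewrite !raddfD IHu tmap_pure !coordr_pure; congr (_ + _).
exact/esym/(linearZ_LR h).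
Qed.

Lemma freemod_tensor_inj (K G : lmodType R) (i : {linear K -> G}) :
  injective i -> forall u, tmap (lid (freemod R^c T)) i u = 0 -> u = 0.
Proof.
move=> iI u iu; have [s ->] := coordr_sum u; apply: big1 => t _.
suff -> : coordr t u = 0 by rewrite pure0r.
by apply: iI; rewrite -coordr_natural iu raddf0 linear0.
Qed.

End TensorFreeRight.

(** * Flat modules *)

Lemma lift_inj (R : pzRingType) (K G U : lmodType R) (j : {linear K -> G})
    (f : {linear U -> G}) :
  injective j -> (forall u, exists k, j k = f u) ->
  exists f' : {linear U -> K}, forall u, j (f' u) = f u.
Proof.
move=> jI ex; have [f' f'E] := choice ex.
have f'L : linear f' by move=> a u v; apply: jI; rewrite linearP !f'E linearP.
by exists (lin f'L) => u; exact: f'E.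
Qed.

Section Flat.
Variable R : pzRingType.
Implicit Types F M K G L : lmodType R.

Lemma flatP F :
  (forall (N1 N2 N3 : lmodType R^c) (g : {linear N1 -> N2}) (h : {linear N2 -> N3}),
    exact g h -> forall u, tmap h (lid F) u = 0 -> exists v, tmap g (lid F) v = u) ->
  flat F.
Proof.
move=> H N1 N2 N3 g h gh u; split=> [|[v <-]]; first exact: H.
by apply: tmapl_comp0 => x; apply/gh; exists x.
Qed.

Lemma flat_exact F (N1 N2 N3 : lmodType R^c) (g : {linear N1 -> N2})
    (h : {linear N2 -> N3}) :
  flat F -> exact g h ->
  forall u, tmap h (lid F) u = 0 -> exists v, tmap g (lid F) v = u.
Proof. by move=> fF gh u; apply: (fF _ _ _ _ _ gh u).1. Qed.

Lemma flat_retract M F : retract M F -> flat F -> flat M.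
Proof.
move=> [i [p pi]] fF; apply: flatP => N1 N2 N3 g h gh u hu.
have [v vE] : exists v, tmap g (lid F) v = tmap (lid N2) i u.
  by apply: flat_exact fF gh _ _; rewrite tmap_swap hu raddf0.
exists (tmap (lid N1) p v); rewrite tmap_swap vE.
elim/tensor_ind: {v hu vE} u => [|x y u IHu]; first by rewrite !raddf0.
by rewrite !raddfD IHu !tmap_pure pi.
Qed.

Lemma flat_sum M F : flat M -> flat F -> flat (M * F)%type.
Proof.
move=> fM fF; apply: flatP => N1 N2 N3 g h gh u hu.
have i1L : linear (fun x : M => (x, 0) : M * F).
  by move=> a x y; congr pair; rewrite /= scaler0 addr0.
have i2L : linear (fun x : F => (0, x) : M * F).
  by move=> a x y; congr pair; rewrite /= scaler0 addr0.
have [v vE] : exists v, tmap g (lid M) v = tmap (lid N2) (fst : {linear (M * F)%type -> M}) u.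
  by apply: flat_exact fM gh _ _; rewrite tmap_swap hu raddf0.
have [w wE] : exists v, tmap g (lid F) v = tmap (lid N2) (snd : {linear (M * F)%type -> F}) u.
  by apply: flat_exact fF gh _ _; rewrite tmap_swap hu raddf0.
exists (tmap (lid N1) (lin i1L) v + tmap (lid N1) (lin i2L) w).
rewrite raddfD !tmap_swap vE wE.
elim/tensor_ind: {v w hu vE wE} u => [|x [y z] u IHu]; first by rewrite !raddf0 addr0.
rewrite !raddfD addrACA IHu !tmap_pure /= -pureDr; congr (pure _ _ + _).
by congr pair; rewrite /= ?addr0 ?add0r.
Qed.

(** This is Tor_1(N, F) = 0.  Lift [z] to P (x) K for a free cover P of [N] with
    kernel S.  Its image in P (x) G comes from some w in S (x) G; the image of w
    in S (x) F vanishes in P (x) F, so it vanishes by flatness of [F], and w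
    comes from S (x) K.  As P (x) K -> P (x) G is injective, the lift of [z]
    itself comes from S (x) K, and dies in N (x) K. *)
Lemma tensor_inj_flat_coker K G F (i : {linear K -> G}) (q : {linear G -> F}) :
  flat G -> flat F -> injective i -> exact i q -> (forall y, exists x, q x = y) ->
  forall (N : lmodType R^c) (z : tensor N K), tmap (lid N) i z = 0 -> z = 0.
Proof.
move=> fG fF iI iq qS N z iz.
pose pi : {linear freemod R^c N -> N} := freemod_ext id.
have piS x : exists y, pi y = x by exists (basis R^c x); apply: freemod_extE.
have [z' z'E] := tmap_surj piS (fun y => ex_intro _ y (erefl : lid K y = y)) z.
pose j := ker_emb pi.
have jpi : exact j pi by apply: exact_ker_emb.
have [w wE] : exists w, tmap j (lid G) w = tmap (lid _) i z'.
  by apply: flat_exact fG jpi _ _; rewrite tmap_swap z'E.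
have qw : tmap (lid _) q w = 0.
  apply: (flat_inj fF (@ker_emb_inj _ _ _ pi)).
  rewrite tmap_swap wE; apply: tmapr_comp0 => k; apply/iq; by exists k.
have [v vE] := tensor_right_exact iq qS qw.
rewrite -z'E; have -> : z' = tmap j (lid K) v.
  apply/eqP; rewrite -subr_eq0; apply/eqP/(freemod_tensor_inj iI).
  by rewrite raddfB -wE -vE -tmap_swap subrr.
by apply: tmapl_comp0 => x; apply/jpi; exists x.
Qed.

(** Given z in N2 (x) K killed in N3 (x) K, flatness of [G] provides w in
    N1 (x) G with the same image in N2 (x) G.  Flatness of [F] corrects w by an
    element that comes from ker g, so that it vanishes in N1 (x) F and comes
    from N1 (x) K. *)
Lemma flat_kernel K G F (i : {linear K -> G}) (q : {linear G -> F}) :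
  flat G -> flat F -> injective i -> exact i q -> (forall y, exists x, q x = y) ->
  flat K.
Proof.
move=> fG fF iI iq qS; apply: flatP => N1 N2 N3 g h gh z hz.
have [w wE] : exists w, tmap g (lid G) w = tmap (lid N2) i z.
  by apply: flat_exact fG gh _ _; rewrite tmap_swap hz raddf0.
pose j := ker_emb g.
have [v vE] : exists v, tmap j (lid F) v = tmap (lid N1) q w.
  apply: flat_exact fF (exact_ker_emb g) _ _; rewrite tmap_swap wE.
  by apply: tmapr_comp0 => k; apply/iq; exists k.
have [v' v'E] := tmap_surj (fun y => ex_intro _ y (erefl : lid _ y = y)) qS v.
have [y yE] : exists y, tmap (lid N1) i y = w - tmap j (lid G) v'.
  by apply: tensor_right_exact iq qS _ _; rewrite raddfB -tmap_swap v'E vE subrr.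
exists y; apply/eqP; rewrite -subr_eq0; apply/eqP.
apply: (tensor_inj_flat_coker fG fF iI iq qS).
have gj0 : tmap g (lid G) (tmap j (lid G) v') = 0.
  apply: tmapl_comp0 => x; exact: (@ker_embK _ _ _ g x).
by rewrite raddfB -tmap_swap yE raddfB wE gj0 subr0 subrr.
Qed.

End Flat.

(** * Flat dimension and direct summands *)

Section FlatDimension.
Variable R : pzRingType.
Implicit Types F M K G L P : lmodType R.

Lemma flat_dim0 M : flat_dim_le M 0 <-> flat M.
Proof.
split=> [[F [d [e [fF F0 eS de _]]]]|fM].
  apply: flat_retract (fF 0%N).
  have eI : injective e.
    move=> x y exy; apply/eqP; rewrite -subr_eq0; apply/eqP.
    have [|z <-] := (de (x - y)).1; first by rewrite linearB exy subrr.
    by rewrite (F0 1%N isT z) linear0.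
  have [i iE] := lift_inj (f := lid M) eI eS.
  by exists i, e => x; exact: iE.
pose Z : lmodType R := submod (zero_submodule M).
have Z0 (x : Z) : x = 0.
  apply: (@emb_inj _ _ _ (zero_submodule M)).
  exact: etrans (@emb_in _ _ _ (zero_submodule M) x) (esym (linear0 _)).
have fZ : flat Z.
  apply: flatP => N1 N2 N3 g h gh u _; exists 0; rewrite raddf0.
  by elim/tensor_ind: u => // x y u <-; rewrite (Z0 y) pure0r addr0.
pose F n : lmodType R := if n is _.+1 then Z else M.
exists F, (fun n => \0 : {linear F n.+1 -> F n}), (lid M); split.
- by case.
- by case=> // n _ x; apply: Z0.
- by move=> y; exists y.
- move=> y; split=> [/= ->|[x <-]] //; by exists 0.
- by move=> n y; split=> // _; exists 0; rewrite (Z0 y).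
Qed.

(** With [flat_dim0], this replaces resolutions by an induction on the first
    syzygy. *)
Lemma flat_dimS M n : flat_dim_le M n.+1 <->
  exists F K (j : {linear K -> F}) (e : {linear F -> M}),
    [/\ flat F, injective j, exact j e, forall y, exists x, e x = y & flat_dim_le K n].
Proof.
split=> [[F [d [e [fF F0 eS de dd]]]]|[G [K [j [e [fG jI je eS]]]]]].
  have [e' e'E] := corestr (ker_submodule e) (f := d 0%N)
    (fun x => (de _).2 (ex_intro _ x erefl)).
  exists (F 0%N), (ker e), (ker_emb e), e; split=> //.
  - exact: emb_inj.
  - exact: exact_ker_emb.
  exists (fun i => F i.+1), (fun i => d i.+1), e'; split=> //.
  - by move=> i ni; apply: F0.
  - move=> y; have /de [x xE] := @ker_embK _ _ _ e y.
    by exists x; apply: (@ker_emb_inj _ _ _ e); rewrite e'E.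
  move=> y; rewrite -dd -e'E; split=> [->|e'y]; first by rewrite linear0.
  by apply: (@ker_emb_inj _ _ _ e); rewrite e'y linear0.
move=> [F [d [e' [fF F0 e'S de' dd]]]].
pose F' i : lmodType R := if i is i'.+1 then F i' else G.
pose d' i : {linear F' i.+1 -> F' i} :=
  if i is i'.+1 return {linear F' i.+1 -> F' i} then d i' else (j \o e').
exists F', d', e; split=> //.
- by case.
- by case=> // i; apply: F0.
- move=> y; rewrite je; split=> [[k <-]|[x <-]]; last by exists (e' x).
  by have [x <-] := e'S k; exists x.
case=> [|i] //=; move=> y; rewrite -de' /=; split=> [|->]; last exact: linear0.
by move=> jy; apply: jI; rewrite jy linear0.
Qed.

(** If a flat module G maps onto [X] with kernel Y, then the preimage of [K] in G
    is the kernel of G -> F, hence flat, and maps onto [K] with the same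
    kernel Y. *)
Lemma flat_dim_kernel n (K X F : lmodType R)
    (i : {linear K -> X}) (q : {linear X -> F}) :
  flat_dim_le X n -> flat F -> injective i -> exact i q ->
  (forall y, exists x, q x = y) -> flat_dim_le K n.
Proof.
case: n => [|n] fX fF iI iq qS.
  by move: fX; rewrite !flat_dim0 => fX; apply: flat_kernel fX fF iI iq qS.
have /flat_dimS [G [Y [j [e [fG jI je eS fY]]]]] := fX; apply/flat_dimS.
pose b := ker_emb (q \o e).
have qeS y : exists x, (q \o e) x = y.
  by have [x <-] := qS y; have [z <-] := eS x; exists z.
have b0 x : q (e (b x)) = 0 by apply: (@ker_embK _ _ _ (q \o e) x).
have [e' e'E] := lift_inj (f := e \o b) iI (fun x => (iq _).1 (b0 x)).
have [|j' j'E] := corestr (ker_submodule (q \o e)) (f := j).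
  by move=> y /=; have -> : e (j y) = 0 by [apply/je; exists y]; rewrite linear0.
exists (ker (q \o e)), Y, j', e'; split=> //.
- exact: flat_kernel fG fF (@ker_emb_inj _ _ _ (q \o e))
    (exact_ker_emb (q \o e)) qeS.
- by move=> x y xy; apply: jI; rewrite -!j'E xy.
- move=> y; transitivity (e (b y) = 0).
    by rewrite -[e (b y)]e'E; split=> [->|e'y]; [exact: linear0|apply: iI; rewrite e'y linear0].
  rewrite je; split=> [[x xE]|[x <-]]; exists x; last by rewrite -j'E.
  by apply: (@ker_emb_inj _ _ _ (q \o e)); rewrite j'E.
move=> k; have [x xE] := eS (i k).
have [|y yE] := emb_lift (ker_submodule (q \o e)) (v := x).
  by rewrite /= xE; apply/iq; exists k.
by exists y; apply: iI; rewrite e'E /= /b yE.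
Qed.

Lemma flat_dim_sum n M P : flat_dim_le M n -> flat P -> flat_dim_le (M * P)%type n.
Proof.
case: n => [|n] fM fP; first by apply/flat_dim0/flat_sum => //; apply/flat_dim0.
have /flat_dimS [G [Y [j [e [fG jI je eS fY]]]]] := fM; apply/flat_dimS.
have jL : linear (fun y => (j y, 0) : G * P).
  by move=> a x y; congr pair; rewrite /= ?linearP // scaler0 addr0.
have eL : linear (fun x : G * P => (e x.1, x.2)).
  by move=> a x y; congr pair; rewrite /= linearP.
exists (G * P)%type, Y, (lin jL), (lin eL); split=> //.
- exact: flat_sum.
- by move=> x y [] /jI.
- move=> [x y]; split=> [[/je [z <-] ->]|[z [<- <-]]]; first by exists z.
  by congr pair; apply/je; exists z.
- by move=> [x y]; have [z zE] := eS x; exists (z, y); rewrite /= zE.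
Qed.

(** Free covers are functorial, so the kernel of free(M) -> M is a retract of
    the kernel K' of free(M') -> M'.  Let F be the given flat module
    that maps onto [M'], with kernel L.  A lift lam : free(M') -> F yields a surjection from
    L (+) free(M') to [F], sending (l, x) to lam x - l, whose kernel is K'.
    Hence K' has flat dimension at most that of L, and induction applies. *)
Lemma flat_dim_retract n M M' : retract M M' -> flat_dim_le M' n -> flat_dim_le M n.
Proof.
elim: n M M' => [|n IHn] M M' rM; first by rewrite !flat_dim0; apply: flat_retract.
move=> /flat_dimS [F [L [j [e [fF jI je eS fL]]]]]; apply/flat_dimS.
have [i [p pi]] := rM.
pose cov (V : lmodType R) : {linear freemod R V -> V} := freemod_ext (V := V) id.
pose iP : {linear freemod R M -> freemod R M'} := freemod_ext (fun x => basis R (i x)).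
pose pP : {linear freemod R M' -> freemod R M} := freemod_ext (fun x => basis R (p x)).
have covS (V : lmodType R) x : exists y, cov V y = x by exists (basis R x); apply: freemod_extE.
have piP x : pP (iP x) = x.
  apply: (freemod_map_eq (f := pP \o iP) (g := lid _)) => t.
  by rewrite /= !freemod_extE pi.
have covi x : cov M' (iP x) = i (cov M x).
  apply: (freemod_map_eq (f := cov M' \o iP) (g := i \o cov M)) => t.
  by rewrite /= !freemod_extE.
have covp x : cov M (pP x) = p (cov M' x).
  apply: (freemod_map_eq (f := cov M \o pP) (g := p \o cov M')) => t.
  by rewrite /= !freemod_extE.
exists (freemod R M), (ker (cov M)), (ker_emb (cov M)), (cov M).
split=> //; [exact: flat_freemod | exact: emb_inj | exact: exact_ker_emb |].
apply: (IHn _ (ker (cov M'))).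
  have [|iK iKE] := corestr (ker_submodule (cov M')) (f := iP \o ker_emb (cov M)).
    move=> x; rewrite /= covi.
    by rewrite (@ker_embK _ _ _ (cov M) x) linear0.
  have [|pK pKE] := corestr (ker_submodule (cov M)) (f := pP \o ker_emb (cov M')).
    move=> x; rewrite /= covp.
    by rewrite (@ker_embK _ _ _ (cov M') x) linear0.
  exists iK, pK => x; apply: (@ker_emb_inj _ _ _ (cov M)).
  by rewrite pKE /= iKE /= piP.
have [s sE] := choice eS.
pose lam : {linear freemod R M' -> F} := freemod_ext s.
have elam x : e (lam x) = cov M' x.
  apply: (freemod_map_eq (f := e \o lam) (g := cov M')) => t.
  by rewrite /= !freemod_extE sE.
have qL : linear (fun z : L * freemod R M' => lam z.2 - j z.1).
  by move=> a z w; rewrite /= (linearP lam) (linearP j) opprD addrACA scalerBr.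
have qS y : exists z, lin qL z = y.
  have [x xE] := covS _ (e y).
  have /je [l lE] : e (lam x - y) = 0 by rewrite linearB elam xE subrr.
  by exists (l, x); rewrite /= lE opprB addrC subrK.
have kerlam x : exists l, j l = lam (ker_emb (cov M') x).
  by apply/je; rewrite elam (@ker_embK _ _ _ (cov M') x).
have [l lE] := lift_inj (f := lam \o ker_emb (cov M')) jI kerlam.
have kL : linear (fun x => (l x, ker_emb (cov M') x)).
  by move=> a x y; congr pair; rewrite linearP.
apply: (flat_dim_kernel (i := lin kL) (q := lin qL)) => //.
- by apply: flat_dim_sum => //; apply: flat_freemod.
- by move=> x y [_ /emb_inj].
move=> [z x]; split=> [/= /eqP|[y [<- <-]]]; last by rewrite /= lE subrr.
rewrite subr_eq0 => /eqP zx.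
have [|y yE] := emb_lift (ker_submodule (cov M')) (v := x).
  by rewrite -elam zx; apply/je; exists z.
by exists y; congr pair => //; apply: jI; rewrite lE /= yE.
Qed.

End FlatDimension.

(** * Coinduced modules *)

Section Coinduced.
Variables (R A : pzRingType) (phi : {rmorphism R -> A}) (M : lmodType R).

Definition semilin (u : A -> M) : Prop :=
  forall r x y, u (phi r * x + y) = r *: u x + u y.

Definition coind_pred : {pred A -> M} := fun u => `[< semilin u >].

Fact coind_zmod_closed : zmod_closed coind_pred.
Proof.
split=> [|u v /asboolP uL /asboolP vL]; apply/asboolP => r x y.
  by rewrite [RHS]addr0 scaler0.
have subE z : (u - v) z = u z - v z by [].
by rewrite !subE uL vL scalerBr opprD addrACA.
Qed.

HB.instance Definition _ :=
  GRing.isZmodClosed.Build (A -> M) coind_pred coind_zmod_closed.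

(** Hom_R(A, M); the action of A, (a u)(x) = u(x a), comes from the right
    multiplication of A on itself. *)
Record coind_type := CoindType {coind_val : A -> M; _ : coind_val \in coind_pred}.

HB.instance Definition _ := [isSub for coind_val].
HB.instance Definition _ := [Choice of coind_type by <:].
HB.instance Definition _ := [SubChoice_isSubZmodule of coind_type by <:].

Definition app (u : coind_type) (x : A) : M := coind_val u x.

Lemma app_semilin u : semilin (app u).
Proof. by case: u => u u_in; exact/asboolP. Qed.

Lemma coind_ext u v : app u =1 app v -> u = v.
Proof. by move=> uv; apply/val_inj/funext. Qed.

Lemma coind_exists f : semilin f -> {u | app u =1 f}.
Proof.
move=> fL; have fL' : f \in coind_pred by exact/asboolP.
by exists (CoindType fL').
Qed.

Fact coind_scale_semilin (a : A) (u : coind_type) : semilin (fun x => app u (x * a)).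
Proof. by move=> r x y; rewrite mulrDl -mulrA app_semilin. Qed.

Definition coind_scale a u : coind_type := sval (coind_exists (coind_scale_semilin a u)).

Fact coind_scaleE a u x : app (coind_scale a u) x = app u (x * a).
Proof. exact: (svalP (coind_exists (coind_scale_semilin a u))). Qed.

Fact coind_addE u v x : app (u + v) x = app u x + app v x.
Proof. by []. Qed.

Fact coind_scaleA a b u : coind_scale a (coind_scale b u) = coind_scale (a * b) u.
Proof. by apply: coind_ext => x; rewrite !coind_scaleE mulrA. Qed.
Fact coind_scale1 : left_id 1 coind_scale.
Proof. by move=> u; apply: coind_ext => x; rewrite !coind_scaleE mulr1. Qed.
Fact coind_scaleDr : right_distributive coind_scale +%R.
Proof.
by move=> a u v; apply: coind_ext => x; rewrite !(coind_addE, coind_scaleE).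
Qed.
Fact coind_scaleDl u : {morph coind_scale^~ u : a b / a + b}.
Proof.
move=> a b; apply: coind_ext => x; rewrite !(coind_addE, coind_scaleE) mulrDr.
by rewrite -[x * a]mul1r -(rmorph1 phi) app_semilin scale1r rmorph1 mul1r.
Qed.

HB.instance Definition _ := GRing.Zmodule_isLmodule.Build A coind_type
  coind_scaleA coind_scale1 coind_scaleDr coind_scaleDl.

Definition coind : lmodType A := coind_type.

Implicit Types u v : coind.

Lemma appZ a u x : app (a *: u) x = app u (x * a).
Proof. exact: coind_scaleE. Qed.

Lemma appD u v x : app (u + v) x = app u x + app v x. Proof. by []. Qed.

Lemma app_sum I (s : seq I) (F : I -> coind) x :
  app (\sum_(i <- s) F i) x = \sum_(i <- s) app (F i) x.
Proof. by elim/big_rec2: _ => // i _ u _ <-. Qed.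

Lemma appDr u : {morph app u : x y / x + y}.
Proof.
by move=> x y; rewrite -[x in LHS]mul1r -(rmorph1 phi) app_semilin scale1r.
Qed.

Lemma appMl u r x : app u (phi r * x) = r *: app u x.
Proof.
have u0 : app u 0 = 0 by exact: raddf0 (addm (appDr u)).
by rewrite -[phi r * x]addr0 app_semilin u0 addr0.
Qed.

Lemma app_sumr u I (s : seq I) (F : I -> A) :
  app u (\sum_(i <- s) F i) = \sum_(i <- s) app u (F i).
Proof. exact: (raddf_sum (addm (appDr u))). Qed.

End Coinduced.

Arguments app {R A phi M} u x : simpl never.

Section CoinducedMap.
Variables (R A : pzRingType) (phi : {rmorphism R -> A}).

Fact cmap_sig (M M' : lmodType R) (f : {linear M -> M'}) :
  {g : {linear coind phi M -> coind phi M'} | forall u x, app (g u) x = f (app u x)}.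
Proof.
have fL (u : coind phi M) : semilin phi (fun x => f (app u x)).
  by move=> r x y; rewrite app_semilin linearP.
pose g u : coind phi M' := sval (coind_exists (fL u)).
have gE u x : app (g u) x = f (app u x) by exact: svalP (coind_exists (fL u)) x.
have gL : linear g.
  move=> a u v; apply: coind_ext => x.
  by rewrite !(gE, appD, appZ) linearD.
by exists (lin gL).
Qed.

Definition cmap (M M' : lmodType R) (f : {linear M -> M'}) :
  {linear coind phi M -> coind phi M'} := sval (cmap_sig f).

Lemma cmapE (M M' : lmodType R) (f : {linear M -> M'}) u x :
  app (cmap f u) x = f (app u x).
Proof. exact: (svalP (cmap_sig f)). Qed.

Lemma cmap_inj (M M' : lmodType R) (f : {linear M -> M'}) :
  injective f -> injective (cmap f).
Proof.
move=> fI u v uv; apply: coind_ext => x; apply: fI.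
by rewrite -!cmapE uv.
Qed.

Fact rmap_linear (M M' : lmodType A) (f : {linear M -> M'}) :
  linear (f : restr phi M -> restr phi M').
Proof. by move=> r x y; exact: (linearP f). Qed.

Definition rmap (M M' : lmodType A) (f : {linear M -> M'}) :
  {linear restr phi M -> restr phi M'} := lin (rmap_linear f).

(** The adjunction Hom_A(N, Hom_R(A, E)) = Hom_R(N, E), in which a map h
    corresponds to its value at 1. *)
Lemma injective_coind (E : lmodType R) :
  injective_module E -> injective_module (coind phi E).
Proof.
move=> injE M N g h gI.
have h1L : linear ((fun m => app (h m) 1) : restr phi M -> E).
  move=> r x y; have -> : h (r *: x + y) = phi r *: h x + h y.
    exact: (linearP h).
  by rewrite appD appZ mul1r -[phi r]mulr1 appMl.
have [h' h'E] := injE _ _ (rmap g) (lin h1L) gI.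
have hnL n : semilin phi (fun x : A => h' (x *: n : N)).
  move=> r x z; have -> : (phi r * x + z) *: n = r *: (x *: n : restr phi N) + z *: n.
    by rewrite scalerDl -scalerA.
  exact: (linearP h').
pose h2 n : coind phi E := sval (coind_exists (hnL n)).
have h2E n x : app (h2 n) x = h' (x *: n : N) by exact: svalP (coind_exists (hnL n)) x.
have h2L : linear h2.
  move=> a m n; apply: coind_ext => x; rewrite appD appZ !h2E.
  by rewrite scalerDr scalerA; exact: (linearD h').
exists (lin h2L) => m; apply: coind_ext => x.
rewrite [LHS](h2E (g m) x) -linearZ [LHS](h'E (x *: m : M)) /=.
by rewrite linearZ appZ mul1r.
Qed.

End CoinducedMap.

(** * Frobenius systems *)

(** The Frobenius form with a pair of dual bases.  Unlike the isomorphism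
    A = Hom_R(A, R), these data are symmetric under passage to opposite rings:
    [e] and [y] trade places. *)
Record frobenius_system (R A : pzRingType) (phi : {rmorphism R -> A})
    (theta : A -> R) n (e y : 'I_n -> A) : Prop := FrobeniusSystem {
  frobD : {morph theta : a b / a + b};
  frobZl : forall r a, theta (phi r * a) = r * theta a;
  frobZr : forall r a, theta (a * phi r) = theta a * r;
  frobl : forall a, a = \sum_i phi (theta (a * y i)) * e i;
  frobr : forall a, a = \sum_i y i * phi (theta (e i * a)) }.

Lemma frobenius_system_op (R A : pzRingType) (phi : {rmorphism R -> A})
    (theta : A -> R) n (e y : 'I_n -> A) :
  frobenius_system phi theta e y ->
  frobenius_system (fop phi) (theta : A^c -> R^c) (y : 'I_n -> A^c) (e : 'I_n -> A^c).
Proof. by case. Qed.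

(** Exactness is transported along maps alpha, beta natural in the right
    module with beta alpha = 1, that is, along a natural retraction. *)
Lemma exact_tensor_transfer (R S : pzRingType) (N1 N2 N3 : lmodType R^c)
    (F : lmodType R) (P1 P2 P3 : lmodType S^c) (G : lmodType S)
    (g : {linear N1 -> N2}) (h : {linear N2 -> N3})
    (g' : {linear P1 -> P2}) (h' : {linear P2 -> P3})
    (alpha2 : {additive tensor N2 F -> tensor P2 G})
    (alpha3 : {additive tensor N3 F -> tensor P3 G})
    (beta1 : {additive tensor P1 G -> tensor N1 F})
    (beta2 : {additive tensor P2 G -> tensor N2 F}) :
  flat G -> exact g' h' ->
  (forall x f, beta2 (alpha2 (pure x f)) = pure x f) ->
  (forall x f, alpha3 (tmap h (lid F) (pure x f)) = tmap h' (lid G) (alpha2 (pure x f))) ->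
  (forall x f, beta2 (tmap g' (lid G) (pure x f)) = tmap g (lid F) (beta1 (pure x f))) ->
  forall u, tmap h (lid F) u = 0 -> exists v, tmap g (lid F) v = u.
Proof.
move=> fG gh' ba ha gb u hu.
have ba' v : beta2 (alpha2 v) = v.
  by elim/tensor_ind: v => [|x f v IHv]; rewrite ?raddf0 // !raddfD ba IHv.
have ha' v : alpha3 (tmap h (lid F) v) = tmap h' (lid G) (alpha2 v).
  by elim/tensor_ind: v => [|x f v IHv]; rewrite ?raddf0 // !raddfD ha IHv.
have gb' v : beta2 (tmap g' (lid G) v) = tmap g (lid F) (beta1 v).
  by elim/tensor_ind: v => [|x f v IHv]; rewrite ?raddf0 // !raddfD gb IHv.
have [|v vE] := flat_exact (u := alpha2 u) fG gh'; first by rewrite -ha' hu raddf0.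
by exists (beta1 v); rewrite -gb' vE ba'.
Qed.

Section FrobeniusSystem.
Variables (R A : pzRingType) (phi : {rmorphism R -> A}).
Variables (theta : A -> R) (n : nat) (e y : 'I_n -> A).
Hypothesis sys : frobenius_system phi theta e y.

Lemma frob_sum I (s : seq I) (F : I -> A) :
  theta (\sum_(i <- s) F i) = \sum_(i <- s) theta (F i).
Proof. exact: (raddf_sum (addm (frobD sys))). Qed.

Lemma app_frob (M : lmodType R) (u : coind phi M) x :
  app u x = \sum_i theta (x * y i) *: app u (e i).
Proof.
rewrite [x in LHS](frobl sys) app_sumr; apply: eq_bigr => i _.
exact: appMl.
Qed.

(** The unit m |-> 1 (x) m of the identification A (x)_R M = Hom_R(A, M). *)
Fact cofree_sig (M : lmodType R) :
  {c : {linear M -> restr phi (coind phi M)} |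
    forall m x, app (c m : coind phi M) x = theta x *: m}.
Proof.
have cL (m : M) : semilin phi (fun x => theta x *: m).
  by move=> r x z; rewrite (frobD sys) (frobZl sys) scalerDl scalerA.
pose c m : coind phi M := sval (coind_exists (cL m)).
have cE m x : app (c m) x = theta x *: m by exact: svalP (coind_exists (cL m)) x.
have cL' : linear (c : M -> restr phi (coind phi M)).
  move=> r m m'; have cD : c (r *: m + m') = phi r *: c m + c m'.
    by apply: coind_ext => x; rewrite appD appZ !cE (frobZr sys) scalerDr scalerA.
  exact: cD.
by exists (lin cL').
Qed.

Definition cofree (M : lmodType R) : {linear M -> restr phi (coind phi M)} :=
  sval (cofree_sig M).

Lemma cofreeE M m x : app (cofree M m : coind phi M) x = theta x *: m.
Proof. exact: (svalP (cofree_sig M)). Qed.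

Lemma cofreeZ (M : lmodType R) r m :
  (cofree M (r *: m) : coind phi M) = phi r *: (cofree M m : coind phi M).
Proof. exact: (linearZ_LR (cofree M) r m). Qed.

(** The identification A (x)_R M = Hom_R(A, M) in formulas: [u] corresponds to
    sum_i y_i (x) u(e_i). *)
Lemma coind_sum (M : lmodType R) (u : coind phi M) :
  u = \sum_i y i *: (cofree M (app u (e i)) : coind phi M).
Proof.
apply: coind_ext => x; rewrite app_sum app_frob; apply: eq_bigr => i _.
by rewrite appZ cofreeE.
Qed.

Lemma coind_lift (M M' : lmodType R) (f : {linear M -> M'}) (u : coind phi M') :
  (forall i, exists m, f m = app u (e i)) -> exists v, cmap phi f v = u.
Proof.
move=> /choice [m mE]; exists (\sum_i y i *: (cofree M (m i) : coind phi M)).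
apply: coind_ext => x; rewrite cmapE app_sum linear_sum [RHS]app_frob.
by apply: eq_bigr => i _; rewrite appZ cofreeE linearZ mE.
Qed.

Lemma coind_exact (M1 M2 M3 : lmodType R)
    (f : {linear M1 -> M2}) (g : {linear M2 -> M3}) :
  exact f g -> exact (cmap phi f) (cmap phi g).
Proof.
move=> fg u; split=> [gu|[v <-]].
  by apply: coind_lift => i; apply/fg; rewrite -cmapE gu.
by apply: coind_ext => x; rewrite !cmapE; apply/fg; exists (app v x).
Qed.

(** Restriction is right adjoint to M |-> A (x)_R M = Hom_R(A, M), which
    preserves injective maps.  So extend an R-map h : M -> J to the A-map
    u |-> sum_i y_i h(u(e_i)) on Hom_R(A, M), then along Hom_R(A, g), and compose
    with the unit of [N]. *)
Lemma injective_restr (J : lmodType A) :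
  injective_module J -> injective_module (restr phi J).
Proof.
move=> injJ M N g h gI.
have HL : linear (fun u : coind phi M => \sum_i y i *: (h (app u (e i)) : J)).
  move=> a u v; rewrite scaler_sumr.
  have -> : \sum_i a *: (y i *: (h (app u (e i)) : J)) =
            \sum_i y i *: (h (app u (e i * a)) : J).
    under eq_bigr do rewrite scalerA [a * _](frobr sys) scaler_suml.
    rewrite exchange_big; apply: eq_bigr => j _.
    rewrite [app u _]app_frob linear_sum scaler_sumr; apply: eq_bigr => i _.
    by rewrite linearZ mulrA -scalerA.
  rewrite -big_split; apply: eq_bigr => i _ /=.
  rewrite -scalerDr appD appZ; congr (_ *: _); exact: (linearD h).
have [K KE] := injJ _ _ (cmap phi g) (lin HL) (cmap_inj (phi := phi) gI).
exists (rmap phi K \o cofree N) => m.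
have cg : cofree N (g m) = cmap phi g (cofree M m : coind phi M) :> coind phi N.
  by apply: coind_ext => x; rewrite cmapE !cofreeE linearZ.
transitivity (K (cofree N (g m) : coind phi N)); first by [].
rewrite cg KE /=.
rewrite -[RHS](scale1r (h m : J)) [1](frobr sys) scaler_suml.
by apply: eq_bigr => i _; rewrite mulr1 cofreeE linearZ -scalerA.
Qed.

(** N (x)_A Hom_R(A, F) = N (x)_R F, by n (x) u |-> sum_i n y_i (x) u(e_i) and
    n (x) f |-> n (x) (x |-> theta(x) f). *)
Section FlatCoind.
Variable F : lmodType R.

Let alpha_ex (N : lmodType A^c) : exists al : {additive tensor N (coind phi F) ->
    tensor (restr (fop phi) N) F}, forall x u, al (pure x u) =
  \sum_i pure (((y i : A^c) *: x : N) : restr (fop phi) N) (app u (e i)).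
Proof.
apply: (tensor_universal (b := fun x (u : coind phi F) =>
  \sum_i pure (((y i : A^c) *: x : N) : restr (fop phi) N) (app u (e i))))
  => [x x' u|x u v|a x u].
- by rewrite -big_split; apply: eq_bigr => i _; rewrite scalerDr; exact: pureDl.
- by rewrite -big_split; apply: eq_bigr => i _; rewrite appD; exact: pureDr.
transitivity (\sum_i \sum_j pure (((y j : A^c) *: x : N) : restr (fop phi) N)
    (theta (e j * a * y i) *: app u (e i))).
  apply: eq_bigr => i _; rewrite scalerA.
  have -> : (y i : A^c) * (a : A^c) = a * y i :> A by [].
  rewrite [a * y i](frobr sys) scaler_suml pure_suml; apply: eq_bigr => j _.
  by rewrite -pureZ mulrA -scalerA.
rewrite exchange_big; apply: eq_bigr => j _.
by rewrite -pure_sumr appZ -app_frob.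
Qed.

Let beta_ex (N : lmodType A^c) : exists be : {additive tensor (restr (fop phi) N) F ->
  tensor N (coind phi F)}, forall x f, be (pure x f) = pure (x : N) (cofree F f : coind phi F).
Proof.
apply: (tensor_universal (b := fun (x : restr (fop phi) N) f =>
  pure (x : N) (cofree F f : coind phi F))) => [x x' f|x f f'|r x f].
- exact: pureDl.
- by rewrite linearD; exact: pureDr.
by rewrite cofreeZ -pureZ.
Qed.

Lemma flat_coind : flat F -> flat (coind phi F).
Proof.
move=> fF; apply: flatP => N1 N2 N3 g h gh.
have [al2 al2E] := alpha_ex N2; have [al3 al3E] := alpha_ex N3.
have [be1 be1E] := beta_ex N1; have [be2 be2E] := beta_ex N2.
apply: (exact_tensor_transfer (g' := rmap (fop phi) g) (h' := rmap (fop phi) h)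
  (alpha2 := al2) (alpha3 := al3) (beta1 := be1) (beta2 := be2) fF gh).
- move=> x u; rewrite al2E raddf_sum [u in RHS]coind_sum pure_sumr.
  by apply: eq_bigr => i _; rewrite be2E -pureZ.
- move=> x u; rewrite tmap_pure al3E al2E raddf_sum; apply: eq_bigr => i _.
  rewrite tmap_pure; congr pure; exact/esym/(linearZ_LR h).
- by move=> x f; rewrite tmap_pure be2E be1E tmap_pure.
Qed.

End FlatCoind.

End FrobeniusSystem.

(** N (x)_R F = Hom_R(A, N) (x)_A F for right R-modules N, by
    n (x) f |-> (x |-> n theta(x)) (x) f and u (x) f |-> sum_i u(y_i) (x) e_i f.
    The coinduced right module is the coinduced module of the opposite rings. *)
Section FlatRestr.
Variables (R A : pzRingType) (phi : {rmorphism R -> A}).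
Variables (theta : A -> R) (n : nat) (e y : 'I_n -> A).
Hypothesis sys : frobenius_system phi theta e y.
Let sysop := frobenius_system_op sys.
Variable F : lmodType A.

Let alpha_ex (N : lmodType R^c) : exists al : {additive tensor N (restr phi F) ->
    tensor (coind (fop phi) N) F}, forall x f,
  al (pure x f) = pure (cofree sysop N x : coind (fop phi) N) (f : F).
Proof.
apply: (tensor_universal (b := fun x (f : restr phi F) =>
  pure (cofree sysop N x : coind (fop phi) N) (f : F))) => [x x' f|x f f'|r x f].
- by rewrite linearD; exact: pureDl.
- exact: pureDr.
by rewrite cofreeZ; exact: pureZ.
Qed.

Let beta_ex (N : lmodType R^c) : exists be : {additive tensor (coind (fop phi) N) F ->
    tensor N (restr phi F)}, forall u f,
  be (pure u f) = \sum_i pure (app u (y i)) (e i *: f : restr phi F).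
Proof.
apply: (tensor_universal (b := fun (u : coind (fop phi) N) f =>
  \sum_i pure (app u (y i)) (e i *: f : restr phi F))) => [u v f|u f f'|a u f].
- by rewrite -big_split; apply: eq_bigr => i _; rewrite appD; exact: pureDl.
- by rewrite -big_split; apply: eq_bigr => i _; rewrite scalerDr; exact: pureDr.
transitivity (\sum_i \sum_j pure ((theta (e j * a * y i) : R^c) *: app u (y j))
    (e i *: f : restr phi F)).
  apply: eq_bigr => i _; rewrite appZ (app_frob sysop) pure_suml.
  by apply: eq_bigr => j _; rewrite -[e j * a * y i]mulrA.
rewrite exchange_big; apply: eq_bigr => j _.
rewrite scalerA [in RHS](frobl sys (e j * a)) scaler_suml pure_sumr.
by apply: eq_bigr => i _; rewrite pureZ -scalerA.
Qed.

Lemma flat_restr : flat F -> flat (restr phi F).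
Proof.
move=> fF; apply: flatP => N1 N2 N3 g h gh.
have [al2 al2E] := alpha_ex N2; have [al3 al3E] := alpha_ex N3.
have [be1 be1E] := beta_ex N1; have [be2 be2E] := beta_ex N2.
apply: (exact_tensor_transfer (g' := cmap (fop phi) g) (h' := cmap (fop phi) h)
  (alpha2 := al2) (alpha3 := al3) (beta1 := be1) (beta2 := be2) fF).
- exact: coind_exact sysop _ _ _ _ _ gh.
- move=> x f; rewrite al2E be2E.
  rewrite -[f in RHS](scale1r (f : F)) [1](frobl sys) scaler_suml pure_sumr.
  by apply: eq_bigr => i _; rewrite mul1r cofreeE pureZ -scalerA.
- move=> x f; rewrite tmap_pure al3E al2E tmap_pure; congr pure.
  by apply: coind_ext => z; rewrite cmapE !cofreeE linearZ_LR.
- move=> u f; rewrite tmap_pure be2E be1E raddf_sum; apply: eq_bigr => i _.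
  by rewrite cmapE tmap_pure.
Qed.

End FlatRestr.

(** * Transfer of the quasi-Gorenstein property *)

Section FlatDimensionTransfer.
Variables (R A : pzRingType) (phi : {rmorphism R -> A}).
Variables (theta : A -> R) (n : nat) (e y : 'I_n -> A).
Hypothesis sys : frobenius_system phi theta e y.

Lemma flat_dim_coind (M : lmodType R) k :
  flat_dim_le M k -> flat_dim_le (coind phi M) k.
Proof.
move=> [F [d [ep [fF F0 epS de dd]]]].
exists (fun i => coind phi (F i)), (fun i => cmap phi (d i)), (cmap phi ep); split.
- by move=> i; apply: flat_coind sys _ (fF i).
- by move=> i ki u; apply: coind_ext => x; apply: F0.
- by move=> u; apply: (coind_lift sys) => i; apply: epS.
- exact: coind_exact sys _ _ _ _ _ de.
- by move=> i; apply: coind_exact sys _ _ _ _ _ (dd i).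
Qed.

Lemma flat_dim_restr (M : lmodType A) k :
  flat_dim_le M k -> flat_dim_le (restr phi M) k.
Proof.
move=> [F [d [ep [fF F0 epS de dd]]]].
exists (fun i => restr phi (F i)), (fun i => rmap phi (d i)), (rmap phi ep); split=> //.
by move=> i; apply: flat_restr sys _ (fF i).
Qed.

End FlatDimensionTransfer.

Lemma retract_quasi_Gorenstein (R : pzRingType) (M : lmodType R)
    (E : nat -> lmodType R) (eta : {linear M -> E 0%N})
    (d : forall i, {linear E i -> E i.+1}) k :
  retract R^o M -> injective_resolution eta d ->
  (forall i, (i < k)%N -> flat_dim_le (E i) i.+1) -> left_quasi_Gorenstein R k.
Proof.
move=> rM res fE.
have [J [eta' [d' [min rJ]]]] := minimal_resolution_of_retract rM res.
exists J, eta', d'; split=> // i ik.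
exact: flat_dim_retract (rJ i) (fE i ik).
Qed.

Lemma minimal_resolutionW (R : pzRingType) (M : lmodType R)
    (E : nat -> lmodType R) (eta : {linear M -> E 0%N})
    (d : forall i, {linear E i -> E i.+1}) :
  minimal_injective_resolution eta d -> injective_resolution eta d.
Proof. by case=> injE etaI [ex0 exS] _ _; split. Qed.

(** The coinduced resolution resolves Hom_R(A, R), which is A by
    a |-> (x |-> theta(x a)). *)
Lemma quasi_Gorenstein_coind (R A : pzRingType) (phi : {rmorphism R -> A})
    (theta : A -> R) n (e y : 'I_n -> A) k :
  frobenius_system phi theta e y ->
  left_quasi_Gorenstein R k -> left_quasi_Gorenstein A k.
Proof.
move=> sys [I [eta [d [/minimal_resolutionW [injI etaI ex0 exS] fI]]]].
have thetaL (a : A) : semilin phi (fun x => theta (x * a) : R^o).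
  by move=> r x z; rewrite mulrDl (frobD sys) -mulrA (frobZl sys).
pose tr a : coind phi R^o := sval (coind_exists (thetaL a)).
have trE a x : app (tr a) x = theta (x * a) by exact: svalP (coind_exists (thetaL a)) x.
have trL : linear (tr : A^o -> coind phi R^o).
  move=> a b c; apply: coind_ext => x; rewrite appD appZ !trE.
  by rewrite mulrDr (frobD sys) mulrA.
have trI : injective tr.
  move=> a b ab; rewrite (frobr sys a) (frobr sys b); apply: eq_bigr => i _.
  by rewrite -!trE ab.
have trS u : exists a, tr a = u.
  exists (\sum_i y i * phi (app u (e i))); apply: coind_ext => x.
  rewrite trE mulr_sumr (app_frob sys).
  by rewrite (frob_sum sys); apply: eq_bigr => i _; rewrite mulrA (frobZr sys).
apply: (retract_quasi_Gorenstein (M := A^o) (E := fun i => coind phi (I i))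
  (eta := cmap phi eta \o lin trL) (d := fun i => cmap phi (d i))).
- by exists (lid A^o), (lid A^o).
- split.
  + by move=> i; apply: injective_coind.
  + by move=> a b /(cmap_inj etaI)/trI.
  + move=> u; rewrite (coind_exact sys ex0) /=; split=> [[v <-]|[a <-]].
      by have [a <-] := trS v; exists a.
    by exists (tr a).
  + by move=> i; apply: coind_exact sys _ _ _ _ _ (exS i).
by move=> i ik; apply: flat_dim_coind sys _ _ (fI i ik).
Qed.

(** The restricted resolution resolves A over R, and r |-> r c exhibits R as a
    summand of A with retraction theta. *)
Lemma quasi_Gorenstein_restr (R A : pzRingType) (phi : {rmorphism R -> A})
    (theta : A -> R) n (e y : 'I_n -> A) c k :
  frobenius_system phi theta e y -> theta c = 1 ->
  left_quasi_Gorenstein A k -> left_quasi_Gorenstein R k.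
Proof.
move=> sys c1 [I [eta [d [/minimal_resolutionW [injI etaI ex0 exS] fI]]]].
apply: (retract_quasi_Gorenstein (M := restr phi A^o) (E := fun i => restr phi (I i))
  (eta := rmap phi eta) (d := fun i => rmap phi (d i))).
- have iL : linear ((fun r => phi r * c) : R^o -> restr phi A^o).
    by move=> a r s; rewrite rmorphD rmorphM mulrDl -mulrA.
  have pL : linear (theta : restr phi A^o -> R^o).
    move=> r x z; exact: etrans (frobD sys _ _) (congr1 (+%R^~ _) (frobZl sys _ _)).
  by exists (lin iL), (lin pL) => r; rewrite /= (frobZl sys) c1 mulr1.
- by split=> // i; apply: injective_restr sys _ _.
by move=> i ik; apply: flat_dim_restr sys _ _ (fI i ik).
Qed.

(** A dual basis (e_i, h_i) of the projective module A consists of elements and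
    functionals; write h_i as theta(- y_i).  The second expansion holds because
    theta(x -) agrees on both sides for every x, and a |-> theta(- a) is
    injective. *)
Lemma frobenius_extension_system (R A : pzRingType) (phi : {rmorphism R -> A}) :
  Frobenius_extension phi -> exists theta n (e y : 'I_n -> A),
    frobenius_system phi theta e y /\ linear (theta : left_restr phi -> R^o).
Proof.
move=> [[n [e span]] proj [Theta [ThetaD ThetaM ThetaZ ThetaI ThetaS]]].
have gL : linear ((fun c => \sum_i (c i : R) *: e i) : {ffun 'I_n -> R^o} -> left_restr phi).
  move=> a b c; rewrite scaler_sumr -big_split; apply: eq_bigr => i _ /=.
  by rewrite !ffunE scalerDl scalerA.
have gS x : exists c, lin gL c = x.
  by have [c ->] := span x; exists [ffun i => c i]; apply: eq_bigr => i _; rewrite ffunE.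
have [s sE] := proj _ _ (lin gL) (lid _) gS.
have sL i : linear (fun x => s x i : R^o).
  by move=> a x z; rewrite linearP !ffunE.
have [y yE] := choice (fun i => ThetaS (lin (sL i))).
pose theta (a : A) : R := Theta 1 a.
have thetaE a x : Theta a x = theta (x * a) by rewrite /theta -ThetaM mulr1.
have thetaD : {morph theta : a b / a + b} by move=> a b; exact: linearD.
have thetaZl r a : theta (phi r * a) = r * theta a by exact: linearZ_LR.
have thetaZr r a : theta (a * phi r) = theta a * r.
  by rewrite -thetaE -[phi r]mul1r ThetaZ thetaE mulr1.
have theta_sum (F : 'I_n -> A) : theta (\sum_i F i) = \sum_i theta (F i).
  exact: (raddf_sum (addm thetaD)).
have fl a : a = \sum_i phi (theta (a * y i)) * e i.
  by rewrite -[LHS]sE /=; apply: eq_bigr => i _; rewrite -thetaE yE.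
exists theta, n, e, y; split; last exact: linearP.
split=> // a; apply: ThetaI => x; rewrite !thetaE.
rewrite [x in LHS]fl mulr_suml mulr_sumr !theta_sum; apply: eq_bigr => i _.
by rewrite -mulrA thetaZl mulrA thetaZr.
Qed.

(** Every x (x) r in A (x)_R R is the image under 1 (x) theta of
    sum_i y_i (x) e_i x r, because sum_i y_i theta(e_i x) = x.  So 1 (x) theta is
    surjective, and faithful flatness makes theta surjective. *)
Lemma frobenius_form_unit (R A : pzRingType) (phi : {rmorphism R -> A})
    (theta : A -> R) n (e y : 'I_n -> A) :
  frobenius_system phi theta e y -> linear (theta : left_restr phi -> R^o) ->
  faithfully_flat_right (right_restr phi) -> exists c, theta c = 1.
Proof.
move=> sys thL ff.
have : exact (lin thL) (\0 : {linear R^o -> R^o}).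
  apply/ff => u; split=> _; last first.
    rewrite -[LHS]/(tmap (lid _) \0 u).
    elim/tensor_ind: u => [|x r u IHu]; first by rewrite raddf0.
    by rewrite raddfD IHu tmap_pure pure0r addr0.
  elim/tensor_ind: u => [|x r u [v <-]].
    by exists 0; exact: (raddf0 (tmap _ _)).
  exists (\sum_i pure (y i : right_restr phi) (e i * x * phi r : left_restr phi) + v).
  rewrite -[LHS]/(tmap (lid _) (lin thL) _) raddfD raddf_sum; congr (_ + _).
  rewrite [x in RHS](frobr sys) pure_suml; apply: eq_bigr => i _.
  rewrite tmap_pure /= (frobZr sys).
  exact/esym/(pureZ (theta (e i * x)) (y i : right_restr phi) (r : R^o)).
by case/(_ 1) => + _ => /(_ erefl) [c cE]; exists c.
Qed.

Theorem corollary5p19 (R A : pzRingType) (phi : {rmorphism R -> A})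
    (HR : noetherian_algebra R) (HA : noetherian_algebra A)
    (Hphi : Frobenius_extension phi)
    (Hff : faithfully_flat_right (right_restr phi))
    (k : nat) (Hk : (0 < k)%N) :
  left_quasi_Gorenstein R k <-> left_quasi_Gorenstein A k.
Proof.
have [theta [n [e [y [sys thL]]]]] := frobenius_extension_system Hphi.
have [c c1] := frobenius_form_unit sys thL Hff.
by split; [apply: quasi_Gorenstein_coind sys | apply: quasi_Gorenstein_restr sys c1].
Qed.
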